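(* Let $(M,\omega)$ be a closed symplectic manifold. A symplectic bundle $(M,\omega)\to E\to B$ is a symplectic configuration if and only if it admits a closed connection two-form.
   Context: A symplectic bundle (fibration) $(M,\omega)\to E\to B$ is a fiber bundle with structure group $\operatorname{Symp}(M,\omega)$; the base is assumed to be a manifold. It is a symplectic configuration if there is a symplectic manifold $(W,\omega_W)$ and a map $E\to W$ whose restriction to every fiber of $E$ is a symplectic embedding. A closed connection two-form on $E$ is a closed two-form $\Omega\in\Omega^2(E)$ that restricts to the symplectic form on every fiber. *)

(* Defs.v *)
From mathcomp Require Import all_boot all_order all_algebra.
From mathcomp Require Import all_classical all_reals all_analysis.

Set Implicit Arguments.
Unset Strict Implicit.
Unset Printing Implicit Defensive.

Import Order.TTheory GRing.Theory Num.Theory.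
Import numFieldNormedType.Exports.

Local Open Scope classical_set_scope.
Local Open Scope ring_scope.

(* Maps defined on an open subset of a space are represented by total functions
   whose values outside that subset are irrelevant. *)

(* In finite dimension, f is C^(k+1) on an open set U iff it is differentiable
   on U and each directional derivative 'D_v f is C^k on U. *)
Fixpoint C_on (R : realType) (V W : normedModType R) (k : nat) (U : set V)
    (f : V -> W) : Prop :=
  match k with
  | 0 => forall x, U x -> {for x, continuous f}
  | k'.+1 => (forall x, U x -> differentiable f x) /\
             (forall v, C_on k' U (fun x => 'D_v f x))
  end.

Definition Cinfty_on (R : realType) (V W : normedModType R) (U : set V)
    (f : V -> W) : Prop :=
  forall k, C_on k U f.

Record chart (R : realType) (n : nat) (X : Type) := Chart {
  chart_dom : set X;
  chart_fun :> X -> 'rV[R]_n;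
  chart_inv : 'rV[R]_n -> X }.

Definition chart_cod (R : realType) n (X : Type) (c : chart R n X)
  : set 'rV[R]_n := c @` chart_dom c.

Definition is_chart (R : realType) n (X : topologicalType) (c : chart R n X)
  : Prop :=
  [/\ open (chart_dom c), open (chart_cod c),
      forall x, chart_dom c x -> chart_inv c (c x) = x,
      forall x, chart_dom c x -> {for x, continuous c} &
      forall y, chart_cod c y -> {for y, continuous (chart_inv c)}].

(* The raw data of a smooth manifold of dimension n; the axioms are stated
   separately in is_manifold. The atlas need not be maximal. *)
Record charted (R : realType) (n : nat) := Charted {
  charted_space :> topologicalType;
  atlas : set (chart R n charted_space) }.
Arguments atlas {R n} M : rename.

Definition local_rep (R : realType) m n (M : charted R m) (N : charted R n)
    (c : chart R m M) (d : chart R n N) (f : M -> N)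
  : 'rV[R]_m -> 'rV[R]_n :=
  fun y => d (f (chart_inv c y)).

Record is_manifold (R : realType) n (M : charted R n) : Prop := {
  manifold_hausdorff : hausdorff_space M;
  manifold_second_countable : @second_countable M;
  manifold_chart : forall c, atlas M c -> is_chart c;
  manifold_cover : forall x : M, exists2 c, atlas M c & chart_dom c x;
  manifold_transition : forall c d, atlas M c -> atlas M d ->
    Cinfty_on (c @` (chart_dom c `&` chart_dom d)) (local_rep c d id) }.

Definition closed_manifold (R : realType) n (M : charted R n) : Prop :=
  is_manifold M /\ compact [set: M].

Definition prod_chart (R : realType) m n (X Y : Type)
    (c : chart R m X) (d : chart R n Y) : chart R (m + n) (X * Y) :=
  {| chart_dom := chart_dom c `*` chart_dom d;
     chart_fun := fun z => row_mx (c z.1) (d z.2);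
     chart_inv := fun y => (chart_inv c (lsubmx y), chart_inv d (rsubmx y)) |}.

Definition prod_charted (R : realType) m n (M : charted R m) (N : charted R n)
  : charted R (m + n) :=
  {| charted_space := (M * N)%type : topologicalType;
     atlas := [set e | exists c d,
                 [/\ atlas M c, atlas N d & e = prod_chart c d]] |}.

(* Smoothness on an open subset A of M. *)
Definition smooth_on (R : realType) m n (M : charted R m) (N : charted R n)
    (A : set M) (f : M -> N) : Prop :=
  (forall x, A x -> {for x, continuous f}) /\
  (forall c d, atlas M c -> atlas N d ->
    Cinfty_on (c @` (A `&` chart_dom c `&` f @^-1` chart_dom d))
              (local_rep c d f)).

Definition smooth_map (R : realType) m n (M : charted R m) (N : charted R n)
    (f : M -> N) : Prop :=
  smooth_on setT f.

Definition diffeo_on (R : realType) m n (M : charted R m) (N : charted R n)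
    (A : set M) (A' : set N) (f : M -> N) (g : N -> M) : Prop :=
  [/\ smooth_on A f, smooth_on A' g,
      forall x, A x -> A' (f x) /\ g (f x) = x &
      forall y, A' y -> A (g y) /\ f (g y) = y].

Definition embedding (R : realType) m n (M : charted R m) (N : charted R n)
    (f : M -> N) : Prop :=
  [/\ smooth_map f,
      forall c d x, atlas M c -> atlas N d ->
        chart_dom c x -> chart_dom d (f x) ->
        row_free (jacobian (local_rep c d f) (c x)),
      injective f &
      forall U : set M, open U -> exists2 V : set N, open V & U = f @^-1` V].

(* omega c x is the Gram matrix, in the coordinate basis of the chart c, of a
   bilinear form on the tangent space at x: the value on the tangent vectors
   with coordinate rows u and v is u *m omega c x *m v^T. Only the values for
   c in the atlas and x in the domain of c matter. *)
Definition form_data (R : realType) n (M : charted R n) : Type :=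
  chart R n M -> M -> 'M[R]_n.

(* f^* eta = omega; the differential acts on row vectors by u |-> u *m J. *)
Definition is_pullback (R : realType) m n (M : charted R m) (N : charted R n)
    (f : M -> N) (eta : form_data N) (omega : form_data M) : Prop :=
  forall c d x, atlas M c -> atlas N d -> chart_dom c x -> chart_dom d (f x) ->
    let J := jacobian (local_rep c d f) (c x) in
    omega c x = J *m eta d (f x) *m J^T.

(* two_form_transition is the change of coordinates rule: for f = id, the
   matrix J of is_pullback is the Jacobian of a transition map. *)
Record two_form (R : realType) n (M : charted R n) (omega : form_data M)
  : Prop := {
  two_form_alternating : forall c x, atlas M c -> chart_dom c x ->
    (omega c x)^T = - omega c x;
  two_form_smooth : forall c, atlas M c ->
    Cinfty_on (chart_cod c) (fun y => omega c (chart_inv c y));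
  two_form_transition : is_pullback id omega omega }.

Definition partial_form (R : realType) n (M : charted R n)
    (omega : form_data M) (c : chart R n M) (y : 'rV[R]_n) (i j k : 'I_n) : R :=
  'D_(delta_mx 0 i) (fun z => omega c (chart_inv c z) j k) y.

Definition closed_form (R : realType) n (M : charted R n)
    (omega : form_data M) : Prop :=
  forall c y, atlas M c -> chart_cod c y -> forall i j k,
    partial_form omega c y i j k + partial_form omega c y j k i
      + partial_form omega c y k i j = 0.

Definition closed_two_form (R : realType) n (M : charted R n)
    (omega : form_data M) : Prop :=
  two_form omega /\ closed_form omega.

Definition symplectic_form (R : realType) n (M : charted R n)
    (omega : form_data M) : Prop :=
  closed_two_form omega /\
  (forall c x, atlas M c -> chart_dom c x -> omega c x \in unitmx).

Definition symplectic_manifold (R : realType) n (M : charted R n)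
    (omega : form_data M) : Prop :=
  is_manifold M /\ symplectic_form omega.

Definition symplectomorphism (R : realType) n (M : charted R n)
    (omega : form_data M) (f : M -> M) : Prop :=
  (exists g : M -> M, diffeo_on setT setT f g) /\ is_pullback f omega omega.

Definition symplectic_embedding (R : realType) m n
    (M : charted R m) (N : charted R n)
    (omega : form_data M) (eta : form_data N) (f : M -> N) : Prop :=
  embedding f /\ is_pullback f eta omega.

(* A local trivialization over the open set triv_dom, with its inverse. *)
Record triv (M B E : Type) := Triv {
  triv_dom : set B;
  triv_fun : E -> B * M;
  triv_inv : B * M -> E }.

Definition is_triv (R : realType) m b e
    (M : charted R m) (B : charted R b) (E : charted R e)
    (p : E -> B) (t : triv M B E) : Prop :=
  [/\ open (triv_dom t),
      @diffeo_on R e (b + m) E (prod_charted B M)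
        (p @^-1` triv_dom t) (triv_dom t `*` setT) (triv_fun t) (triv_inv t) &
      forall x, triv_dom t (p x) -> (triv_fun t x).1 = p x].

(* For y in triv_dom t, a parametrization of the fiber over y by M. *)
Definition fiber_param (M B E : Type) (t : triv M B E) (y : B) : M -> E :=
  fun x => triv_inv t (y, x).

(* T is a bundle atlas with transition functions in Symp(M, omega). *)
Record symplectic_bundle (R : realType) m b e
    (M : charted R m) (B : charted R b) (E : charted R e)
    (omega : form_data M) (p : E -> B) (T : set (triv M B E)) : Prop := {
  bundle_base : is_manifold B;
  bundle_total : is_manifold E;
  bundle_proj : smooth_map p;
  bundle_triv : forall t, T t -> is_triv p t;
  bundle_cover : forall y : B, exists2 t, T t & triv_dom t y;
  bundle_group : forall t s y, T t -> T s -> triv_dom t y -> triv_dom s y ->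
    symplectomorphism omega (fun x => (triv_fun s (fiber_param t y x)).2) }.

(* Each fiber carries the symplectic structure transported from (M, omega)
   by any trivialization of T; by bundle_group the choice does not matter. *)
Definition symplectic_configuration (R : realType) m b e
    (M : charted R m) (B : charted R b) (E : charted R e)
    (omega : form_data M) (T : set (triv M B E)) : Prop :=
  exists w (W : charted R w) (omegaW : form_data W) (f : E -> W),
    [/\ symplectic_manifold omegaW, smooth_map f &
        forall t y, T t -> triv_dom t y ->
          symplectic_embedding omega omegaW (f \o fiber_param t y)].

Definition closed_connection_form (R : realType) m b e
    (M : charted R m) (B : charted R b) (E : charted R e)
    (omega : form_data M) (T : set (triv M B E)) (Omega : form_data E) : Prop :=
  closed_two_form Omega /\
  (forall t y, T t -> triv_dom t y ->
    is_pullback (fiber_param t y) Omega omega).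

(* Main.v *)
(* Pulling back the symplectic form along the configuration map gives a closed
   connection form. Conversely, given a closed connection form Omega, let W be
   the pullback of the cotangent bundle of B along p. The form
   Omega + (canonical form), which reads [Omega, -P; P^T, 0] in coordinates
   with P the Jacobian of p, is closed. It is nondegenerate on all of W: since
   p is a submersion whose fibers are parametrized by M, this only requires
   that Omega be nondegenerate on ker P, the tangent space of the fiber. The
   configuration map is the zero section of W. *)

Require Import Defs.
From HB Require Import structures.
From mathcomp Require Import all_boot all_order all_algebra.
From mathcomp Require Import all_classical all_reals all_analysis.
From mathcomp Require Import ring lra.

Set Implicit Arguments.
Unset Strict Implicit.
Unset Printing Implicit Defensive.

Import Order.TTheory GRing.Theory Num.Theory.
Import numFieldNormedType.Exports.

Local Open Scope classical_set_scope.
Local Open Scope ring_scope.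

(** * Smooth maps between normed modules *)

(** [Omega] may be degenerate in horizontal directions, so [E] with [Omega] is in general no target
    for a configuration; the cotangent directions of [B] supply the missing dual partners. The
    canonical part vanishes along the zero section, so adding it does not disturb the restriction of
    [Omega] to the fibers. The obstacle is that forms are given chart by chart as Gram matrices, so
    the block matrices must be shown to fit together. The Jacobian of a transition map of W has an
    off-diagonal block with second derivatives of a transition map of [B], and its contribution
    cancels because a Hessian is symmetric. The same symmetry makes the pullback of a closed form
    closed. Both directions therefore rest on the symmetry of second derivatives, which is derived
    from [C_on] by the mean value theorem. As a set, W consists of points of [E] with a row of
    coefficients relative to an arbitrarily chosen chart of [B] at the image point; the cocycle rule
    for Jacobians removes the choice from all coordinate expressions. *)

Section differentiability.
Variables (R : realType) (V W : normedModType R).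
Implicit Types (f g : V -> W).

Lemma near_eq_differentiable f g x :
  {near x, f =1 g} -> differentiable f x -> differentiable g x.
Proof.
move=> fg /diff_locallyP[cdf fo].
have go : g \o shift x = cst (g x) + 'd f x +o_ 0 id.
  apply/eqaddoP => e e0; have /eqaddoP/(_ _ e0) := fo.
  have fg0 : \forall h \near (0 : V), f (h + x) = g (h + x).
    have : (fun h : V => h + x) @ (0 : V) --> x.
      rewrite -[X in _ --> X]add0r.
      by apply: cvgD; [exact: cvg_id|exact: cvg_cst].
    by move/(_ _ fg).
  apply: filterS2 fg0 => h.
  by rewrite !fctE /= => ->; rewrite (nbhs_singleton fg).
by apply/diff_locallyP; rewrite (diff_unique cdf go).
Unshelve. all: by end_near. Qed.

End differentiability.

Lemma jacobianE (R : realType) m n (f : 'rV[R]_m -> 'rV[R]_n) x i j :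
  differentiable f x -> jacobian f x i j = ('D_(delta_mx 0 i) f x) 0 j.
Proof. by move=> df; rewrite mxE deriveE. Qed.

Lemma near_eq_jacobian (R : realType) m n (f g : 'rV[R]_m -> 'rV[R]_n) x :
  {near x, f =1 g} -> differentiable f x -> jacobian f x = jacobian g x.
Proof.
move=> fg df; have dg := near_eq_differentiable fg df.
apply/matrixP => i j; apply: (eq_trans (jacobianE i j df)).
by rewrite (near_eq_derive _ fg); exact/esym/jacobianE.
Qed.

Section C_on.
Variables (R : realType) (V : normedModType R).

(** [C_on] tests every level point by point and ['D_v f] is a total function, so the quantifier over
    [U] moves outside the recursion. On a singleton only the germ of the function matters. *)
Lemma C_on_pointwise (W : normedModType R) k U (f : V -> W) :
  C_on k U f <-> (forall x, U x -> C_on k [set x] f).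
Proof.
elim: k f => [|k IH] f /=.
  by split=> [fc x Ux _ ->|fc x Ux]; [exact: fc|exact: (fc x Ux x)].
split=> [[df Df] x Ux|H].
  split=> [y ->|v]; [exact: df|]; move/IH: (Df v); exact.
split=> [x Ux|v]; first by have [d _] := H x Ux; exact: d.
by apply/IH => x Ux; have [_] := H x Ux; exact.
Qed.

Lemma near_eq_C_on (W : normedModType R) k (f g : V -> W) x :
  {near x, f =1 g} -> C_on k [set x] f -> C_on k [set x] g.
Proof.
elim: k f g => [|k IH] f g fg /=.
  move=> fc _ ->; have := fc x erefl.
  rewrite /prop_for /continuous_at (nbhs_singleton fg) => cf.
  by apply: cvg_trans cf; apply: near_eq_cvg; exact: fg.
move=> [df Df]; split=> [_ ->|v].
  by apply: near_eq_differentiable fg _; exact: df.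
(* Functions that agree near [x] agree near every [y] close to [x], so their derivatives have the
   same germ at [x]. *)
apply: IH (Df v); near=> y; apply: near_eq_derive.
by near: y; exact: near_join.
Unshelve. all: by end_near. Qed.

Lemma eq_C_on (W : normedModType R) k U (f g : V -> W) :
  open U -> {in U, f =1 g} -> C_on k U f -> C_on k U g.
Proof.
move=> oU fg /C_on_pointwise fk; apply/C_on_pointwise => x Ux.
apply: near_eq_C_on (fk x Ux); near=> y; apply: fg; rewrite inE; near: y.
exact: open_nbhs_nbhs.
Unshelve. all: by end_near. Qed.

Lemma C_onS (W : normedModType R) k U (f : V -> W) :
  C_on k.+1 U f -> C_on k U f.
Proof.
elim: k f => [|k IH] f [df Df]; first by move=> x /df/differentiable_continuous.
by split=> // v; apply: IH; exact: Df.
Qed.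

Lemma C_on_cst (W : normedModType R) k U (a : W) :
  C_on k U (fun _ : V => a).
Proof.
elim: k a => [|k IH] a /=; first by move=> x _; exact: cst_continuous.
split=> [x _|v]; first exact: differentiable_cst.
have -> : (fun x => 'D_v (fun=> a) x) = (fun _ : V => 0 : W).
  by apply/funext => x; exact: derive_cst.
exact: IH.
Qed.

(** The rule for the derivative of a sum is available only on [U], where both functions are
    differentiable; openness of [U] lets [eq_C_on] exchange the two expressions. Products and
    continuous linear maps follow the same pattern. *)
Lemma C_on_add (W : normedModType R) k U (f g : V -> W) : open U ->
  C_on k U f -> C_on k U g -> C_on k U (fun x => f x + g x).
Proof.
move=> oU; elim: k f g => [|k IH] f g.
  by move=> fc gc x Ux; apply: continuousD; [exact: fc|exact: gc].
move=> [df Df] [dg Dg]; split=> [x Ux|v].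
  by apply: differentiableD; [exact: df|exact: dg].
apply: eq_C_on (IH _ _ (Df v) (Dg v)) => // x; rewrite inE => Ux.
by rewrite -deriveD//; apply: diff_derivable; [exact: df|exact: dg].
Qed.

Lemma C_on_mul k U (f g : V -> R) : open U ->
  C_on k U f -> C_on k U g -> C_on k U (fun x => f x * g x).
Proof.
move=> oU; elim: k f g => [|k IH] f g.
  by move=> fc gc x Ux; apply: continuousM; [exact: fc|exact: gc].
move=> fk gk; have [df Df] := fk; have [dg Dg] := gk; split=> [x Ux|v].
  by apply: differentiableM; [exact: df|exact: dg].
apply: eq_C_on (C_on_add oU (IH _ _ (C_onS fk) (Dg v))
   (IH _ _ (C_onS gk) (Df v))) => // x; rewrite inE => Ux.
rewrite -[RHS]/('D_v (f * g) x) deriveM//; apply: diff_derivable;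
  by [exact: df|exact: dg].
Qed.

Lemma C_on_lin (W W' : normedModType R) k U (L : {linear W -> W'})
    (f : V -> W) : open U -> continuous L ->
  C_on k U f -> C_on k U (fun x => L (f x)).
Proof.
move=> oU cL; elim: k f => [|k IH] f.
  by move=> fc x Ux; apply: continuous_comp; [exact: fc|exact: cL].
move=> [df Df]; split=> [x Ux|v].
  by apply: differentiable_comp; [exact: df|exact: linear_differentiable].
apply: eq_C_on (IH _ (Df v)) => // x; rewrite inE => Ux.
have dfx := df x Ux; have dL := linear_differentiable (f x) cL.
have dLc := diff_lin (f x) cL.
apply/esym/(eq_trans (deriveE v (differentiable_comp dfx dL))).
apply: (eq_trans (congr1 (@^~ v) (diff_comp dfx dL))).
by apply: (eq_trans (congr1 (@^~ _) dLc)); rewrite deriveE.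
Qed.

Lemma C_on_sum (W : normedModType R) k U (I : Type) (r : seq I) (P : pred I)
    (f : I -> V -> W) : open U -> (forall i, P i -> C_on k U (f i)) ->
  C_on k U (fun x => \sum_(i <- r | P i) f i x).
Proof.
move=> oU fk; elim: r => [|i r IH].
  rewrite (_ : (fun _ => _) = fun=> 0); last first.
    by apply/funext => x; rewrite big_nil.
  exact: C_on_cst.
case: (boolP (P i)) => Pi; under eq_fun do rewrite big_cons ?Pi ?(negbTE Pi)//.
  exact: C_on_add (fk _ Pi) IH.
by [].

Qed.

Lemma C_on_mx m n k U (f : V -> 'M[R]_(m, n)) : open U ->
  C_on k U f <-> forall i j, C_on k U (fun x => f x i j : R).
Proof.
move=> oU; split=> [fk i j|fk].
  have @L : {linear 'M[R]_(m, n) -> R}.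
    by exists (fun N : 'M[R]_(_, _) => N i j); do 2![eexists];
      do ?[constructor]; rewrite ?mxE// => ? *; rewrite ?mxE//; move=> ?;
      rewrite !mxE.
  by apply: (C_on_lin (L := L)) => //; exact: coord_continuous.
have -> : f = fun x => \sum_i \sum_j f x i j *: delta_mx i j.
  by apply/funext => x; exact: matrix_sum_delta.
apply: C_on_sum => // i _; apply: C_on_sum => // j _.
have Llin : linear ( *:%R^~ (delta_mx i j) : R -> 'M[R]_(m, n)).
  by move=> a u v; rewrite scalerDl -scalerA.
pose LM := GRing.isLinear.Build _ _ _ _ _ Llin.
pose L : {linear _ -> _} :=
  HB.pack ( *:%R^~ (delta_mx i j) : R -> 'M[R]_(m, n)) LM.
apply: (C_on_lin (L := L)) (fk i j) => //.
exact: scalel_continuous.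
Qed.

End C_on.

Lemma diff_sum_delta (R : realType) (W : normedModType R) n
    (g : 'rV[R]_n -> W) y w : 
  'd g y w = \sum_i w 0 i *: 'd g y (delta_mx 0 i).
Proof.
have dD (u v : 'rV[R]_n) : 'd g y (u + v) = 'd g y u + 'd g y v.
  exact: linearD.
have dZ a (u : 'rV[R]_n) : 'd g y (a *: u) = a *: 'd g y u by exact: linearZ.
rewrite {1}(row_sum_delta w).
elim/big_ind2: _ => [|u u' v v' <- <-|i _]; rewrite ?dD ?dZ//.
by rewrite -[X in 'd g y X](scale0r (0 : 'rV[R]_n)) dZ scale0r.
Qed.

Lemma derive_comp_rV (R : realType) (V W : normedModType R) n
    (f : V -> 'rV[R]_n) (g : 'rV[R]_n -> W) x v :
  differentiable f x -> differentiable g (f x) ->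
  'D_v (g \o f) x = \sum_i ('D_v f x) 0 i *: 'D_(delta_mx 0 i) g (f x).
Proof.
move=> df dg; rewrite deriveE; last exact: differentiable_comp.
rewrite diff_comp//= diff_sum_delta.
by apply: eq_bigr => i _; rewrite !deriveE.
Qed.

(** The chain rule writes a derivative of [g \o f] as a sum of products of entries of ['D_v f] with
    partial derivatives of [g] composed with [f]. The induction therefore has to vary [g]. *)
Lemma C_on_comp (R : realType) (V W : normedModType R) n k U U'
    (f : V -> 'rV[R]_n) (g : 'rV[R]_n -> R) :
  open U -> open U' -> U `<=` f @^-1` U' ->
  C_on k U f -> C_on k U' g -> C_on k U (g \o f).
Proof.
move=> oU oU' UU'; elim: k f UU' g => [|k IH] f UU' g.
  move=> fc gc x Ux; apply: continuous_comp; first exact: fc.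
  by apply: gc; exact: UU'.
move=> fk; have [df Df] := fk; move=> [dg Dg]; split=> [x Ux|v].
  by apply: differentiable_comp; [exact: df|apply: dg; exact: UU'].
pose h x := \sum_i ('D_v f x) 0 i * 'D_(delta_mx 0 i) g (f x).
apply: (@eq_C_on _ _ _ _ _ h) => //.
  move=> x; rewrite inE => Ux; rewrite derive_comp_rV//; first exact: df.
  by apply: dg; exact: UU'.
apply: C_on_sum => // i _; apply: C_on_mul => //.
  exact: (iffLR (C_on_mx _ _ oU) (Df v)).
exact: (IH f UU' _ (C_onS fk) (Dg _)).
Qed.

Section smooth_at.
Variables (R : realType).

(* [C_on k U] only depends on the germs of f at the points of U, which makes
   smoothness on an open set a pointwise property. *)
Definition smooth_at (V W : normedModType R) (f : V -> W) (x : V) : Prop :=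
  \forall y \near x, forall k, C_on k [set y] f.

Lemma smooth_atP (V W : normedModType R) (f : V -> W) x :
  smooth_at f x <-> exists U, [/\ open U, U x & Cinfty_on U f].
Proof.
rewrite /smooth_at /prop_near1 nbhsE; split=> [[U [oU Ux] fU]|[U [oU Ux fU]]].
  by exists U; split=> // k; apply/C_on_pointwise => y /fU; exact.
by exists U => // y Uy k; move/C_on_pointwise: (fU k); exact.
Qed.

Lemma Cinfty_onP (V W : normedModType R) (f : V -> W) U : open U ->
  Cinfty_on U f <-> forall x, U x -> smooth_at f x.
Proof.
move=> oU; split=> [fU x Ux|fU k]; first by apply/smooth_atP; exists U.
by apply/C_on_pointwise => x /fU/nbhs_singleton; exact.
Qed.

Lemma near_smooth_at (V W : normedModType R) (f : V -> W) x :
  smooth_at f x -> \near x, smooth_at f x.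
Proof. exact: near_join. Qed.

Lemma near_eq_smooth_at (V W : normedModType R) (f g : V -> W) x :
  {near x, f =1 g} -> smooth_at f x -> smooth_at g x.
Proof.
move=> /near_join; apply: filterS2 => y fg fk k.
exact: near_eq_C_on (fk k).
Qed.

Lemma smooth_at_continuous (V W : normedModType R) (f : V -> W) x :
  smooth_at f x -> {for x, continuous f}.
Proof. by move=> /nbhs_singleton/(_ 0%N x); exact. Qed.

Lemma smooth_at_differentiable (V W : normedModType R) (f : V -> W) x :
  smooth_at f x -> differentiable f x.
Proof. by move=> /nbhs_singleton/(_ 1%N)[+ _]; exact. Qed.

Lemma smooth_at_derive (V W : normedModType R) (f : V -> W) v x :
  smooth_at f x -> smooth_at ('D_v f) x.
Proof. by apply: filterS => y fk k; have [_] := fk k.+1; exact. Qed.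

Lemma smooth_at_cst (V W : normedModType R) (a : W) (x : V) :
  smooth_at (fun=> a) x.
Proof. by apply: nearW => y k; exact: C_on_cst. Qed.

Lemma smooth_at_add (V W : normedModType R) (f g : V -> W) x :
  smooth_at f x -> smooth_at g x -> smooth_at (fun x => f x + g x) x.
Proof.
move=> /smooth_atP[U [oU Ux fU]] /smooth_atP[U' [oU' Ux' gU]].
apply/smooth_atP; exists (U `&` U'); split=> //; first exact: openI.
move=> k; apply: C_on_add; first exact: openI.
  by apply/C_on_pointwise => y [Uy _]; move/C_on_pointwise: (fU k); exact.
by apply/C_on_pointwise => y [_ Uy]; move/C_on_pointwise: (gU k); exact.
Qed.

Lemma smooth_at_mul (V : normedModType R) (f g : V -> R) x :
  smooth_at f x -> smooth_at g x -> smooth_at (fun x => f x * g x) x.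
Proof.
move=> /smooth_atP[U [oU Ux fU]] /smooth_atP[U' [oU' Ux' gU]].
apply/smooth_atP; exists (U `&` U'); split=> //; first exact: openI.
move=> k; apply: C_on_mul; first exact: openI.
  by apply/C_on_pointwise => y [Uy _]; move/C_on_pointwise: (fU k); exact.
by apply/C_on_pointwise => y [_ Uy]; move/C_on_pointwise: (gU k); exact.
Qed.

Lemma smooth_at_sum (V W : normedModType R) (I : Type) (r : seq I)
    (P : pred I) (f : I -> V -> W) x : (forall i, P i -> smooth_at (f i) x) ->
  smooth_at (fun x => \sum_(i <- r | P i) f i x) x.
Proof.
move=> fx; elim: r => [|i r IH].
  by under eq_fun do rewrite big_nil; exact: smooth_at_cst.
case: (boolP (P i)) => Pi; under eq_fun do rewrite big_cons ?Pi ?(negbTE Pi)//.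
  exact: smooth_at_add (fx _ Pi) IH.
by [].

Qed.

Lemma smooth_at_mx (V : normedModType R) m n (f : V -> 'M[R]_(m, n)) x :
  smooth_at f x <-> forall i j, smooth_at (fun x => f x i j : R) x.
Proof.
split=> [/smooth_atP[U [oU Ux fU]] i j|fx].
  apply/smooth_atP; exists U; split=> // k.
  exact: (iffLR (C_on_mx _ _ oU) (fU k)).
have : \forall y \near x,
    forall ij : 'I_m * 'I_n, forall k, C_on k [set y] (fun x => f x ij.1 ij.2).
  by apply: filter_forall => -[i j]; exact: fx.
rewrite /prop_near1 nbhsE => -[U [oU Ux] fU].
apply/smooth_atP; exists U; split=> // k; apply/C_on_mx => // i j.
by apply/C_on_pointwise => y /fU/(_ (i, j)); exact.
Qed.

Lemma smooth_at_comp (V : normedModType R) m n p (f : V -> 'rV[R]_n)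
    (g : 'rV[R]_n -> 'M[R]_(m, p)) x :
  smooth_at f x -> smooth_at g (f x) -> smooth_at (g \o f) x.
Proof.
move=> /smooth_atP[U [oU Ux fU]] /smooth_atP[U' [oU' Ux' gU]].
have oUU' : open (U `&` f @^-1` U').
  rewrite openE => y [Uy Uy']; apply: filterI; first exact: open_nbhs_nbhs.
  by apply: (fU 0%N y Uy); exact: open_nbhs_nbhs.
apply/smooth_atP; exists (U `&` f @^-1` U'); split=> //.
move=> k; apply/C_on_mx => // i j.
apply: (@C_on_comp _ _ _ _ _ _ U' f (fun z => g z i j)) => //.
- by apply/C_on_pointwise => y [Uy _]; move/C_on_pointwise: (fU k); exact.
- exact: (iffLR (C_on_mx _ _ oU') (gU k)).
Qed.

Lemma smooth_at_mulmx (V : normedModType R) m n p (f : V -> 'M[R]_(m, n))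
    (g : V -> 'M[R]_(n, p)) x :
  smooth_at f x -> smooth_at g x -> smooth_at (fun x => f x *m g x) x.
Proof.
move=> /smooth_at_mx fx /smooth_at_mx gx; apply/smooth_at_mx => i j.
under eq_fun do rewrite mxE.
by apply: smooth_at_sum => k _; exact: smooth_at_mul.
Qed.

Lemma smooth_at_trmx (V : normedModType R) m n (f : V -> 'M[R]_(m, n)) x :
  smooth_at f x -> smooth_at (fun x => (f x)^T) x.
Proof.
move=> /smooth_at_mx fx; apply/smooth_at_mx => i j.
by under eq_fun do rewrite mxE; exact: fx.
Qed.

Lemma smooth_at_id m n (x : 'M[R]_(m, n)) : smooth_at id x.
Proof.
apply/smooth_atP; exists setT; split=> //; first exact: openT.
move=> [|k] /=; first by move=> z _; exact: cvg_id.
split=> // v; rewrite (_ : (fun _ => _) = fun=> v); first exact: C_on_cst.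
by apply/funext => z; exact: derive_id.
Qed.

Lemma smooth_at_block_mx (V : normedModType R) m1 m2 n1 n2
    (f1 : V -> 'M[R]_(m1, n1)) (f2 : V -> 'M[R]_(m1, n2))
    (f3 : V -> 'M[R]_(m2, n1)) (f4 : V -> 'M[R]_(m2, n2)) x :
  smooth_at f1 x -> smooth_at f2 x -> smooth_at f3 x -> smooth_at f4 x ->
  smooth_at (fun x => block_mx (f1 x) (f2 x) (f3 x) (f4 x)) x.
Proof.
move=> /smooth_at_mx f1x /smooth_at_mx f2x /smooth_at_mx f3x /smooth_at_mx f4x.
apply/smooth_at_mx => i j.
under eq_fun do rewrite mxE; case: splitP => k _; under eq_fun do rewrite mxE;
  by case: splitP => l _.
Qed.

Lemma smooth_at_row_mx (V : normedModType R) m n1 n2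
    (f1 : V -> 'M[R]_(m, n1)) (f2 : V -> 'M[R]_(m, n2)) x :
  smooth_at f1 x -> smooth_at f2 x ->
  smooth_at (fun x => row_mx (f1 x) (f2 x)) x.
Proof.
move=> /smooth_at_mx f1x /smooth_at_mx f2x; apply/smooth_at_mx => i j.
by under eq_fun do rewrite mxE; case: splitP => k _.
Qed.

Lemma smooth_at_lsubmx m n1 n2 (x : 'M[R]_(m, n1 + n2)) :
  smooth_at (@lsubmx R m n1 n2) x.
Proof.
have /smooth_at_mx idx := smooth_at_id x; apply/smooth_at_mx => i j.
by under eq_fun do rewrite mxE; exact: idx.
Qed.

Lemma smooth_at_rsubmx m n1 n2 (x : 'M[R]_(m, n1 + n2)) :
  smooth_at (@rsubmx R m n1 n2) x.
Proof.
have /smooth_at_mx idx := smooth_at_id x; apply/smooth_at_mx => i j.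
by under eq_fun do rewrite mxE; exact: idx.
Qed.

Lemma smooth_at_opp (V : normedModType R) m n (f : V -> 'M[R]_(m, n)) x :
  smooth_at f x -> smooth_at (fun x => - f x) x.
Proof.
move=> fx; under eq_fun do rewrite -scaleN1r -mul_scalar_mx.
by apply: smooth_at_mulmx => //; exact: smooth_at_cst.
Qed.

End smooth_at.

(** * Symmetry of second derivatives *)

Lemma eq_second_difference (R : realType) (h a1 a2 a3 a4 P Q : R) : 0 < h ->
  a1 - a2 - (a3 - a4) = P * h * h -> a1 - a3 - (a2 - a4) = Q * h * h -> P = Q.
Proof.
move=> h0 e1 e2; have hn : h != 0 by rewrite gt_eqF.
by apply: (mulIf hn); apply: (mulIf hn); rewrite -e1 -e2; ring.
Qed.

Lemma dist_le_halves (R : realType) (e a b p : R) :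
  `|a - p| < e / 2 -> `|b - p| < e / 2 -> `|a - b| <= e.
Proof.
move=> ap; rewrite distrC => pb; rewrite -(subrKA p) ltW//.
by rewrite (le_lt_trans (ler_normD _ _))// [ltRHS]splitr ltrD.
Qed.

Section schwarz.
Variables (R : realType) (V : normedModType R).

Lemma is_derive_line (W : normedModType R) (f : V -> W) (z u : V) (s : R) :
  differentiable f (z + s *: u) ->
  is_derive s 1 (fun r : R => f (z + r *: u)) ('D_u f (z + s *: u)).
Proof.
move=> df; pose l (r : R) := z + r *: u.
have dl : is_diff s l (fun r => 0 + r *: u).
  by apply: is_diffD; exact: is_diff_scalel.
have dfl : differentiable (f \o l) s by apply: differentiable_comp.
apply: DeriveDef; first exact: diff_derivable.
rewrite -[LHS]/('D_1 (f \o l) s) deriveE// diff_comp//= deriveE//.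
by rewrite diff_val add0r scale1r.
Qed.

(* Mean value theorem in each variable of (s, t) |-> f (x + s u + t v). *)
Lemma second_difference (f : V -> R) (x u v : V) (h : R) : 0 < h ->
  (forall s t, 0 <= s <= h -> 0 <= t <= h ->
    differentiable f (x + s *: u + t *: v) /\
    differentiable ('D_u f) (x + s *: u + t *: v)) ->
  exists s t, [/\ 0 <= s <= h, 0 <= t <= h &
    f (x + h *: u + h *: v) - f (x + h *: u) - (f (x + h *: v) - f x)
    = 'D_v ('D_u f) (x + s *: u + t *: v) * h * h].
Proof.
move=> h0 df; have h00 : 0 <= h <= h by rewrite lexx ltW.
have z0 : 0 <= (0 : R) <= h by apply/andP; split; [exact: lexx|exact: ltW].
pose phi (s : R) := f (x + h *: v + s *: u) - f (x + s *: u).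
have dphi (s : R) : 0 <= s <= h -> is_derive s 1 phi
    ('D_u f (x + h *: v + s *: u) - 'D_u f (x + s *: u)).
  move=> sh; apply: is_deriveB; apply: is_derive_line.
    by rewrite addrAC; have [] := df s h sh h00.
  by have [] := df s 0 sh z0; rewrite scale0r addr0.
have itv (s : R) : (s \in `[0, h]) = (0 <= s <= h) by rewrite in_itv.
have itvo (s : R) : s \in `]0, h[ -> 0 <= s <= h.
  by rewrite in_itv /= => /andP[/ltW-> /ltW->].
have [|s sI Es] := MVT_segment (ltW h0) (fun s sI => dphi s (itvo s sI)).
  apply: derivable_within_continuous => s; rewrite itv => sI.
  by have [] := dphi s sI.
rewrite itv in sI.
pose psi (t : R) := 'D_u f (x + s *: u + t *: v).
have dpsi (t : R) : 0 <= t <= h -> is_derive t 1 psi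
    ('D_v ('D_u f) (x + s *: u + t *: v)).
  by move=> th; apply: is_derive_line; have [] := df s t sI th.
have [|t tI Et] := MVT_segment (ltW h0) (fun t tI => dpsi t (itvo t tI)).
  apply: derivable_within_continuous => t; rewrite itv => tI.
  by have [] := dpsi t tI.
rewrite itv in tI; exists s, t; split=> //.
move: Es Et; rewrite /phi /psi !scale0r !addr0 !subr0 => Es Et.
by rewrite -Et [x + h *: u + _]addrAC (addrAC x (s *: u)) opprB addrA addrAC
  -addrA -[RHS]Es opprB addrA [LHS]addrAC addrA.
Qed.

(** The second difference of [f] over a parallelogram does not change when [u] and [v] are
    exchanged, so the mean value theorem makes the two mixed derivatives equal at two possibly
    different points of it. Continuity of both at [x] brings these values within [e] of each other
    at [x]. *)
Lemma schwarz (f : V -> R) (x u v : V) : smooth_at f x ->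
  'D_u ('D_v f) x = 'D_v ('D_u f) x.
Proof.
move=> fx; apply/eqP; rewrite -subr_eq0 -normr_le0; apply/ler_addgt0Pr => e e0.
rewrite add0r.
have cuv : {for x, continuous ('D_u ('D_v f))}.
  by apply: smooth_at_continuous; do 2 apply: smooth_at_derive.
have cvu : {for x, continuous ('D_v ('D_u f))}.
  by apply: smooth_at_continuous; do 2 apply: smooth_at_derive.
have [r r0 xr] : exists2 r : R, 0 < r & forall y, `|x - y| < r ->
   [/\ smooth_at f y, `|'D_u ('D_v f) x - 'D_u ('D_v f) y| < e / 2 &
       `|'D_v ('D_u f) x - 'D_v ('D_u f) y| < e / 2].
  have e20 : 0 < e / 2 by rewrite divr_gt0.
  have A := near_smooth_at fx.
  have B : \forall y \near x, `|'D_u ('D_v f) x - 'D_u ('D_v f) y| < e / 2.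
    by move/cvgrPdist_lt/(_ _ e20): cuv.
  have C : \forall y \near x, `|'D_v ('D_u f) x - 'D_v ('D_u f) y| < e / 2.
    by move/cvgrPdist_lt/(_ _ e20): cvu.
  have : \forall y \near x, [/\ smooth_at f y,
       `|'D_u ('D_v f) x - 'D_u ('D_v f) y| < e / 2 &
       `|'D_v ('D_u f) x - 'D_v ('D_u f) y| < e / 2].
    by apply: filterS3 A B C => y ? ? ?; split.
  by move=> /nbhs_normP[r /= r0 xr]; exists r => // y xy; exact: xr.
(* With this choice [h] times the sum of the norms of [u] and [v] is [r / 2 - h], so all points with
   parameters in [0, h] lie within [r] of [x]. The summand 1 keeps the denominator positive. *)
pose h := r / (1 + `|u| + `|v|) / 2.
have d0 : 0 < 1 + `|u| + `|v| by rewrite !ltr_wpDr.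
have h0 : 0 < h by rewrite !divr_gt0.
have hr (a b : V) (s t : R) : `|a| + `|b| = `|u| + `|v| ->
    0 <= s <= h -> 0 <= t <= h -> `|x - (x + s *: a + t *: b)| < r.
  move=> ab /andP[s0 sh] /andP[t0 th].
  rewrite -addrA opprD addNKr normrN (le_lt_trans (ler_normD _ _))//.
  rewrite !normrZ !ger0_norm//.
  rewrite (@le_lt_trans _ _ (h * (`|a| + `|b|)))//.
    by rewrite mulrDr lerD// ler_wpM2r.
  have hE : h * (`|u| + `|v|) = r / 2 - h.
    by rewrite /h; field; rewrite gt_eqF.
  by rewrite ab hE; lra.
have df (a b : V) : `|a| + `|b| = `|u| + `|v| ->
    forall s t, 0 <= s <= h -> 0 <= t <= h ->
    differentiable f (x + s *: a + t *: b) /\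
    differentiable ('D_a f) (x + s *: a + t *: b).
  move=> ab s t sh th; have [fy _ _] := xr _ (hr _ _ _ _ ab sh th).
  split; apply: smooth_at_differentiable => //.
  exact: smooth_at_derive.
have vu : `|v| + `|u| = `|u| + `|v| by rewrite addrC.
have [s [t [sh th E1]]] := second_difference h0 (df u v erefl).
have [s' [t' [sh' th' E2]]] := second_difference h0 (df v u vu).
have [_ _ A] := xr _ (hr _ _ _ _ erefl sh th).
have [_ B _] := xr _ (hr _ _ _ _ vu sh' th').
have E : 'D_v ('D_u f) (x + s *: u + t *: v)
       = 'D_u ('D_v f) (x + s' *: v + t' *: u).
  rewrite (addrAC x (h *: v)) in E2.
  exact: eq_second_difference h0 E1 E2.
rewrite -E in B.
exact: dist_le_halves B A.
Qed.

End schwarz.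

(** * Jacobians and pullbacks of closed forms *)

Section jacobian.
Variables (R : realType).

Lemma derive_coord (V : normedModType R) m n (f : V -> 'M[R]_(m, n)) x v i j :
  differentiable f x -> ('D_v f x) i j = 'D_v (fun y => f y i j) x.
Proof. by move=> df; rewrite derive_mx ?mxE//; exact: diff_derivable. Qed.

Lemma jacobian_coord m n (f : 'rV[R]_m -> 'rV[R]_n) x i j :
  differentiable f x ->
  jacobian f x i j = 'D_(delta_mx 0 i) (fun y => f y 0 j) x.
Proof. by move=> df; rewrite jacobianE// derive_coord. Qed.

Lemma jacobian_comp m n p (f : 'rV[R]_m -> 'rV[R]_n) (g : 'rV[R]_n -> 'rV[R]_p)
    x : differentiable f x -> differentiable g (f x) ->
  jacobian (g \o f) x = jacobian f x *m jacobian g (f x).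
Proof.
move=> df dg; apply/matrixP => i j.
rewrite jacobianE; last exact: differentiable_comp.
rewrite derive_comp_rV// mxE summxE; apply: eq_bigr => k _.
by rewrite mxE !jacobianE.
Qed.

Lemma jacobian_mulmxr m n (A : 'M[R]_(m, n)) x :
  jacobian (fun x : 'rV[R]_m => x *m A) x = A.
Proof.
have sx : smooth_at (fun x : 'rV[R]_m => x *m A) x.
  by apply: smooth_at_mulmx; [exact: smooth_at_id|exact: smooth_at_cst].
apply/matrixP => i j.
rewrite jacobianE; last exact: smooth_at_differentiable.
suff -> : 'D_(delta_mx 0 i) (fun x : 'rV[R]_m => x *m A) x = delta_mx 0 i *m A.
  by rewrite -rowE mxE.
rewrite /derive; apply: lim_near_cst => //.
rewrite near_withinE; apply: nearW => h h0 /=.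
by rewrite mulmxDl addrK -scalemxAl scalerA mulVf// scale1r.
Qed.

Lemma jacobian_id m (x : 'rV[R]_m) : jacobian id x = 1%:M.
Proof.
rewrite -[RHS](jacobian_mulmxr _ x); congr jacobian.
by apply/funext => y; rewrite mulmx1.
Qed.

Lemma jacobian_cst m n (a : 'rV[R]_n) (x : 'rV[R]_m) :
  jacobian (fun=> a) x = 0.
Proof.
apply/matrixP => i j; rewrite jacobianE; last exact: differentiable_cst.
by rewrite derive_cst !mxE.
Qed.

Lemma jacobian_lsubmx n1 n2 (x : 'rV[R]_(n1 + n2)) :
  jacobian (@lsubmx R 1 n1 n2) x = col_mx 1%:M 0.
Proof.
rewrite -[RHS](jacobian_mulmxr _ x); congr jacobian; apply/funext => y.
by rewrite -[y in RHS]hsubmxK mul_row_col mulmx1 mulmx0 addr0.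
Qed.

Lemma smooth_at_jacobian m n (f : 'rV[R]_m -> 'rV[R]_n) x :
  smooth_at f x -> smooth_at (jacobian f) x.
Proof.
move=> fx; apply/smooth_at_mx => i j.
have /smooth_at_mx/(_ 0 j) := smooth_at_derive (delta_mx 0 i) fx.
apply: near_eq_smooth_at; apply: filterS (near_smooth_at fx) => y fy.
by rewrite jacobianE//; exact: smooth_at_differentiable.
Qed.

Lemma differentiable_mx m n p (f : 'rV[R]_m -> 'M[R]_(n, p)) x :
  smooth_at f x -> forall i j, differentiable (fun y => f y i j) x.
Proof.
move=> fx i j; apply: smooth_at_differentiable.
by move/smooth_at_mx: fx.
Qed.

Lemma derive_jacobian m n (f : 'rV[R]_m -> 'rV[R]_n) x v i j :
  smooth_at f x -> 'D_v (fun y => jacobian f y i j) x =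
    'D_v ('D_(delta_mx 0 i) (fun y => f y 0 j)) x.
Proof.
move=> fx; apply: near_eq_derive; apply: filterS (near_smooth_at fx) => y.
by move=> /smooth_at_differentiable fy; rewrite jacobianE// derive_coord.
Qed.

Lemma derive_jacobianC m n (f : 'rV[R]_m -> 'rV[R]_n) x i j k :
  smooth_at f x ->
  'D_(delta_mx 0 i) (fun y => jacobian f y j k) x =
  'D_(delta_mx 0 j) (fun y => jacobian f y i k) x.
Proof.
move=> fx; have /smooth_at_mx/(_ 0 k) fkx := fx.
apply: (eq_trans (derive_jacobian _ _ _ fx)).
apply: (eq_trans (schwarz _ _ fkx)).
exact/esym/(derive_jacobian _ _ _ fx).
Qed.

Lemma derive_comp_entry m n (f : 'rV[R]_m -> 'rV[R]_n) (g : 'rV[R]_n -> R)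
    x i : differentiable f x -> differentiable g (f x) ->
  'D_(delta_mx 0 i) (fun y => g (f y)) x =
  \sum_k jacobian f x i k * 'D_(delta_mx 0 k) g (f x).
Proof.
move=> df dg; rewrite -[LHS]/('D_(delta_mx 0 i) (g \o f) x) derive_comp_rV//.
by apply: eq_bigr => k _; rewrite jacobianE.
Qed.

Lemma jacobian_row_mx m n1 n2 (f : 'rV[R]_m -> 'rV[R]_n1)
    (g : 'rV[R]_m -> 'rV[R]_n2) x : smooth_at f x -> smooth_at g x ->
  jacobian (fun y => row_mx (f y) (g y)) x =
  row_mx (jacobian f x) (jacobian g x).
Proof.
move=> fx gx; have fgx := smooth_at_row_mx fx gx.
have df := smooth_at_differentiable fx.
have dg := smooth_at_differentiable gx.
have dfg := smooth_at_differentiable fgx.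
apply/matrixP => i j; rewrite (jacobian_coord _ _ dfg) [RHS]mxE.
case: split_ordP => k ->;
  rewrite (jacobian_coord _ _ df, jacobian_coord _ _ dg).
  rewrite (_ : (fun y => _ 0 (lshift _ _)) = fun y => f y 0 k)//.
  by apply/funext => y; rewrite row_mxEl.
rewrite (_ : (fun y => _ 0 (rshift _ _)) = fun y => g y 0 k)//.
by apply/funext => y; rewrite row_mxEr.
Qed.

End jacobian.

(** * Closedness in coordinates and its invariance under pullback *)

Section closed_at.
Variables (R : realType).

Definition closed_at n (eta : 'rV[R]_n -> 'M[R]_n) (x : 'rV[R]_n) : Prop :=
  forall i j k, 'D_(delta_mx 0 i) (fun y => eta y j k) x
    + 'D_(delta_mx 0 j) (fun y => eta y k i) x
    + 'D_(delta_mx 0 k) (fun y => eta y i j) x = 0.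

Lemma near_eq_closed_at n (eta eta' : 'rV[R]_n -> 'M[R]_n) x :
  {near x, eta =1 eta'} -> closed_at eta x -> closed_at eta' x.
Proof.
move=> ee cl i j k; rewrite -[RHS](cl i j k).
by congr (_ + _ + _); apply: near_eq_derive; apply: filterS ee => y ->.
Qed.

Lemma derive_mul3 (V : normedModType R) (f g h : V -> R) x v :
  smooth_at f x -> smooth_at g x -> smooth_at h x ->
  'D_v (fun y => f y * g y * h y) x =
  'D_v f x * g x * h x + f x * 'D_v g x * h x + f x * g x * 'D_v h x.
Proof.
move=> fx gx hx; have fgx := smooth_at_mul fx gx.
have D k : smooth_at k x -> derivable k x v.
  by move=> kx; apply/diff_derivable/smooth_at_differentiable.
rewrite -[LHS]/('D_v ((f * g) * h) x) deriveM; [|exact: D|exact: D].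
rewrite deriveM; [|exact: D|exact: D].
by rewrite -![_ *: _]/(_ * _) -[(f * g) x]/(f x * g x); ring.
Qed.

Lemma smooth_at_derivable (V W : normedModType R) (f : V -> W) x v :
  smooth_at f x -> derivable f x v.
Proof. by move=> fx; exact/diff_derivable/smooth_at_differentiable. Qed.

Lemma derive_sum_fun (V W : normedModType R) (I : Type) (r : seq I)
    (f : I -> V -> W) x v : (forall i, smooth_at (f i) x) ->
  'D_v (fun y => \sum_(i <- r) f i y) x = \sum_(i <- r) 'D_v (f i) x.
Proof.
move=> fx; elim: r => [|i r IH].
  by rewrite [RHS]big_nil; under eq_fun do rewrite big_nil; exact: derive_cst.
rewrite [RHS]big_cons -IH; under eq_fun do rewrite big_cons.
rewrite -deriveD//; first exact: smooth_at_derivable.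
by apply: smooth_at_derivable; exact: smooth_at_sum.
Qed.

(* In the proof, A is the part of the derivative of the pulled back form that
   contains the second derivatives H i j a of the map, symmetric in i and j. *)
Lemma cyclic_sum_pullback m n (J : 'I_m -> 'I_n -> R) (N : 'I_n -> 'I_n -> R)
    (H : 'I_m -> 'I_m -> 'I_n -> R) (D : 'I_n -> 'I_n -> 'I_n -> R)
    (w : 'I_m -> 'I_m -> 'I_m -> R) :
  (forall a b, N b a = - N a b) -> (forall i j a, H i j a = H j i a) ->
  (forall a b c, D a b c + D b c a + D c a b = 0) ->
  (forall i j k, w i j k = \sum_a \sum_b (H i j a * N a b * J k b
     + J j a * (\sum_c J i c * D c a b) * J k b + J j a * N a b * H i k b)) ->
  forall i j k, w i j k + w j k i + w k i j = 0.
Proof.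
move=> altN symH cycD wE i j k.
pose A i j k := \sum_a \sum_b H i j a * N a b * J k b.
pose B i j k := \sum_a \sum_b \sum_c J i a * J j b * J k c * D a b c.
have AE i' j' k' : w i' j' k' = A i' j' k' + B i' j' k' - A i' k' j'.
  rewrite wE.
  under eq_bigr do rewrite big_split /= big_split /=.
  rewrite big_split /= big_split /=; congr (_ + _ + _).
    rewrite /B [RHS]exchange_big /=; apply: eq_bigr => a _.
    rewrite [RHS]exchange_big /=; apply: eq_bigr => b _.
    by rewrite mulr_sumr mulr_suml; apply: eq_bigr => c _; ring.
  rewrite -sumrN exchange_big /=; apply: eq_bigr => b _.
  rewrite -sumrN; apply: eq_bigr => a _; rewrite altN; ring.
have symA i' j' k' : A i' j' k' = A j' i' k'.
  by apply: eq_bigr => a _; apply: eq_bigr => b _; rewrite symH.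
have BE : B i j k + B j k i + B k i j = 0.
  have -> : B j k i = \sum_a \sum_b \sum_c J i a * J j b * J k c * D b c a.
    rewrite /B; under eq_bigr do rewrite exchange_big /=.
    rewrite exchange_big /=; apply: eq_bigr => a _; apply: eq_bigr => b _.
    by apply: eq_bigr => c _; ring.
  have -> : B k i j = \sum_a \sum_b \sum_c J i a * J j b * J k c * D c a b.
    rewrite /B exchange_big /=; apply: eq_bigr => a _.
    rewrite exchange_big /=; apply: eq_bigr => b _.
    by apply: eq_bigr => c _; ring.
  rewrite /B -!big_split /=; apply: big1 => a _.
  rewrite -!big_split /=; apply: big1 => b _.
  rewrite -!big_split /=; apply: big1 => c _.
  by rewrite -!mulrDr cycD mulr0.
rewrite !AE (symA j i) (symA k i) (symA k j).
by rewrite -[RHS]BE; ring.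
Qed.

(** The exterior derivative commutes with pullback: the product rule on the entries of J eta J^T
    gives terms with second derivatives of [f], which cancel cyclically by symmetry, and terms that
    form the cyclic sum of [eta] weighted by entries of J. *)
Lemma closed_at_pullback m n (f : 'rV[R]_m -> 'rV[R]_n)
    (eta : 'rV[R]_n -> 'M[R]_n) x :
  smooth_at f x -> smooth_at eta (f x) -> (eta (f x))^T = - eta (f x) ->
  closed_at eta (f x) ->
  closed_at (fun y => jacobian f y *m eta (f y) *m (jacobian f y)^T) x.
Proof.
move=> fx etax alt cl.
have Jx i j : smooth_at (fun y => jacobian f y i j) x.
  by have /smooth_at_mx := smooth_at_jacobian fx; exact.
have ex i j : smooth_at (fun y => eta (f y) i j) x.
  by have /smooth_at_mx := smooth_at_comp fx etax; exact.
have df := smooth_at_differentiable fx.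
have de i j : differentiable (fun y => eta y i j) (f x).
  exact: differentiable_mx.
apply: (@cyclic_sum_pullback _ _ (jacobian f x) (eta (f x))
  (fun i j a => 'D_(delta_mx 0 i) (fun y => jacobian f y j a) x)
  (fun c a b => 'D_(delta_mx 0 c) (fun y => eta y a b) (f x))
  (fun i j k => 'D_(delta_mx 0 i) (fun y =>
     (jacobian f y *m eta (f y) *m (jacobian f y)^T) j k) x)) => //.
- by move=> a b; move/matrixP/(_ a b) : alt; rewrite !mxE.
- by move=> i j a; exact: derive_jacobianC.
move=> i j k.
have -> : (fun y => (jacobian f y *m eta (f y) *m (jacobian f y)^T) j k) =
  fun y => \sum_a \sum_b jacobian f y j a * eta (f y) a b * jacobian f y k b.
  apply/funext => y; rewrite mxE exchange_big /=; apply: eq_bigr => b _.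
  by rewrite mxE mulr_suml; apply: eq_bigr => a _; rewrite [_^T _ _]mxE.
rewrite derive_sum_fun => [|a]; last first.
  apply: smooth_at_sum => b _.
  by apply: smooth_at_mul => //; exact: smooth_at_mul.
apply: eq_bigr => a _; rewrite derive_sum_fun => [|b]; last first.
  by apply: smooth_at_mul => //; exact: smooth_at_mul.
apply: eq_bigr => b _.
by rewrite derive_mul3// (derive_comp_entry _ _ (de a b)).
Qed.

End closed_at.

(** * Smooth maps and forms on manifolds *)

Section charts.
Variables (R : realType).

Lemma nbhs_chart_dom n (X : topologicalType) (c : chart R n X) x :
  is_chart c -> chart_dom c x -> nbhs x (chart_dom c).
Proof. by move=> [od _ _ _ _] xc; exact: open_nbhs_nbhs. Qed.

(** Turns statements near a point of the manifold into statements near its coordinates. The domain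
    and inverse identities are included so that local representatives can be simplified under the
    same filter. *)
Lemma near_chart n (X : topologicalType) (c : chart R n X) x (P : set X) :
  is_chart c -> chart_dom c x -> nbhs x P ->
  \forall y \near c x,
    [/\ P (chart_inv c y), chart_dom c (chart_inv c y) &
        c (chart_inv c y) = y].
Proof.
move=> [od oc cK cc ic] xc Px.
have cx : chart_cod c (c x) by exists x.
have icx := ic _ cx; rewrite /prop_for /continuous_at cK// in icx.
have A : nbhs (c x) (chart_cod c) by exact: open_nbhs_nbhs.
by apply: filterS2 A (icx _ Px) => y [z zc <-]; rewrite /= cK.
Qed.

Lemma open_chart_image n (X : topologicalType) (c : chart R n X) (A : set X) :
  is_chart c -> open A -> A `<=` chart_dom c -> open (c @` A).
Proof.
move=> ch oA Ac; rewrite openE => _ [x Ax <-].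
have := near_chart ch (Ac _ Ax) (open_nbhs_nbhs (conj oA Ax)).
by apply: filterS => y [? ? ?]; exists (chart_inv c y).
Qed.

(** The part of [is_manifold] on which pointwise arguments rely. It is all that is established for
    the product, and for the bundle of covectors it comes before the manifold property. *)
Definition chart_space n (M : charted R n) : Prop :=
  (forall c, atlas M c -> is_chart c) /\
  (forall x : M, exists2 c, atlas M c & chart_dom c x).

Lemma manifold_chart_space n (M : charted R n) : is_manifold M -> chart_space M.
Proof. by case. Qed.

Definition smooth_pt m n (M : charted R m) (N : charted R n) (f : M -> N)
    (x : M) : Prop :=
  {for x, continuous f} /\
  forall c d, atlas M c -> atlas N d -> chart_dom c x -> chart_dom d (f x) ->
    smooth_at (local_rep c d f) (c x).

(** Continuity of [f] makes the coordinate domain in [smooth_on] open, and on an open set smoothness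
    is a pointwise condition. *)
Lemma smooth_onP m n (M : charted R m) (N : charted R n) A (f : M -> N) :
  chart_space M -> chart_space N -> open A ->
  smooth_on A f <-> forall x, A x -> smooth_pt f x.
Proof.
move=> [Mc _] [Nc _] oA.
have oS c d : (forall x, A x -> {for x, continuous f}) ->
    atlas M c -> atlas N d ->
    open (c @` (A `&` chart_dom c `&` f @^-1` chart_dom d)).
  move=> fc cM dN; apply: open_chart_image; [exact: Mc| |by move=> x [[]]].
  rewrite openE => x [[Ax cx] dx]; apply: filterI.
    apply: filterI; first exact: open_nbhs_nbhs.
    exact: nbhs_chart_dom (Mc _ cM) cx.
  exact: fc (nbhs_chart_dom (Nc _ dN) dx).
split=> [[fc fS] x Ax|fA].
  split=> [|c d cM dN cx dx]; first exact: fc.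
  move/Cinfty_onP: (fS c d cM dN); apply; first exact: oS.
  by exists x.
have fc x : A x -> {for x, continuous f} by move=> /fA[].
split=> // c d cM dN; apply/Cinfty_onP; first exact: oS.
by move=> _ [x [[Ax cx] dx] <-]; have [_] := fA x Ax; exact.
Qed.

Lemma smooth_mapP m n (M : charted R m) (N : charted R n) (f : M -> N) :
  chart_space M -> chart_space N ->
  smooth_map f <-> forall x, smooth_pt f x.
Proof.
move=> Mc Nc; split=> [/smooth_onP fM x|fM].
  by apply: fM => //; exact: openT.
by apply/smooth_onP => //; exact: openT.
Qed.

Lemma near_eq_local_rep m n (M : charted R m) (N : charted R n) (f g : M -> N)
    c d x : is_chart c -> chart_dom c x -> {near x, f =1 g} ->
  {near c x, local_rep c d f =1 local_rep c d g}.
Proof.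
move=> ch cx fg; have := near_chart ch cx fg; apply: filterS => y [fgy _ _].
by rewrite /local_rep fgy.
Qed.

Definition jac m n (M : charted R m) (N : charted R n) (f : M -> N)
    (c : chart R m M) (d : chart R n N) (x : M) : 'M[R]_(m, n) :=
  jacobian (local_rep c d f) (c x).

Lemma near_eq_jac m n (M : charted R m) (N : charted R n) (f g : M -> N) c d x :
  chart_space M -> atlas M c -> atlas N d ->
  chart_dom c x -> chart_dom d (f x) -> {near x, f =1 g} -> smooth_pt f x ->
  jac f c d x = jac g c d x.
Proof.
move=> [Mc _] cM dN cx dx fg [_ fs]; apply: near_eq_jacobian.
  exact: near_eq_local_rep (Mc _ cM) cx fg.
exact: smooth_at_differentiable (fs _ _ cM dN cx dx).
Qed.

Section composition.
Variables (m n p : nat) (M : charted R m) (N : charted R n) (P : charted R p).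
Variables (f : M -> N) (g : N -> P) (x : M).
Hypotheses (Mc : chart_space M) (Nc : chart_space N).
Hypotheses (fx : smooth_pt f x) (gx : smooth_pt g (f x)).

Lemma near_local_rep_comp c d e : atlas M c -> atlas N d ->
  chart_dom c x -> chart_dom d (f x) ->
  {near c x, local_rep d e g \o local_rep c d f =1 local_rep c e (g \o f)}.
Proof.
move=> cM dN cx dx; have [fc _] := fx.
have dch := Nc.1 _ dN; have [_ _ dK _ _] := dch.
have := near_chart (Mc.1 _ cM) cx (fc _ (nbhs_chart_dom dch dx)).
by apply: filterS => y [fdy _ _]; rewrite /local_rep /= dK.
Qed.

Lemma local_rep_at c d : atlas M c -> chart_dom c x ->
  local_rep c d f (c x) = d (f x).
Proof.
by move=> cM cx; have [_ _ cK _ _] := Mc.1 _ cM; rewrite /local_rep cK.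
Qed.

Lemma smooth_pt_comp : smooth_pt (g \o f) x.
Proof.
split; first by apply: continuous_comp; [exact: fx.1|exact: gx.1].
move=> c e cM eP cx ex; have [d dN dx] := Nc.2 (f x).
apply: near_eq_smooth_at (near_local_rep_comp e cM dN cx dx) _.
apply: smooth_at_comp; first exact: fx.2.
by rewrite local_rep_at//; exact: gx.2.
Qed.

Lemma jac_comp c d e : atlas M c -> atlas N d -> atlas P e ->
  chart_dom c x -> chart_dom d (f x) -> chart_dom e (g (f x)) ->
  jac (g \o f) c e x = jac f c d x *m jac g d e (f x).
Proof.
move=> cM dN eP cx dx ex; rewrite /jac.
have df := smooth_at_differentiable (fx.2 _ _ cM dN cx dx).
have dg := smooth_at_differentiable (gx.2 _ _ dN eP dx ex).
rewrite -(local_rep_at d cM cx) in dg *.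
rewrite -(jacobian_comp df dg); apply/esym/near_eq_jacobian.
  exact: near_local_rep_comp.
exact: differentiable_comp.
Qed.

End composition.

(** This is [manifold_transition] at a point. It allows transition maps to be treated as local
    representatives of [id], so that changes of chart become instances of the chain rule. *)
Lemma smooth_pt_id n (M : charted R n) (x : M) : is_manifold M ->
  smooth_pt id x.
Proof.
move=> Mm; have Mc := manifold_chart_space Mm; split=> // c d cM dM cx dx.
have /Cinfty_onP : open (c @` (chart_dom c `&` chart_dom d)).
  apply: open_chart_image; [exact: Mc.1| |by move=> ? []].
  have [? _ _ _ _] := Mc.1 _ cM; have [? _ _ _ _] := Mc.1 _ dM.
  exact: openI.
move=> /(_ _ (local_rep c d id)) [+ _].
by apply; [exact: manifold_transition|exists x].
Qed.

Lemma jac_id n (M : charted R n) (x : M) c : chart_space M -> atlas M c ->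
  chart_dom c x -> jac id c c x = 1%:M.
Proof.
move=> Mc cM cx; rewrite -(jacobian_id (c x)); apply/esym/near_eq_jacobian.
  have := near_chart (Mc.1 _ cM) cx (@filterT _ _ (nbhs_filter x)).
  by apply: filterS => y [].
exact: smooth_at_differentiable (smooth_at_id (c x)).
Qed.

Lemma jac_changel m n (M : charted R m) (N : charted R n) (f : M -> N)
    x c c' d :
  is_manifold M -> smooth_pt f x ->
  atlas M c -> atlas M c' -> atlas N d ->
  chart_dom c x -> chart_dom c' x -> chart_dom d (f x) ->
  jac f c d x = jac id c c' x *m jac f c' d x.
Proof.
move=> Mm fx cM c'M dN cx c'x dx; have Mc := manifold_chart_space Mm.
exact: (jac_comp Mc Mc (smooth_pt_id x Mm) fx cM c'M dN cx c'x dx).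
Qed.

Lemma jac_changer m n (M : charted R m) (N : charted R n) (f : M -> N)
    x c d d' :
  chart_space M -> is_manifold N -> smooth_pt f x ->
  atlas M c -> atlas N d -> atlas N d' ->
  chart_dom c x -> chart_dom d (f x) -> chart_dom d' (f x) ->
  jac f c d' x = jac f c d x *m jac id d d' (f x).
Proof.
move=> Mc Nm fx cM dN d'N cx dx d'x; have Nc := manifold_chart_space Nm.
exact: (jac_comp Mc Nc fx (smooth_pt_id (f x) Nm) cM dN d'N cx dx d'x).
Qed.

End charts.

(** * Pullbacks of two-forms between manifolds *)

Section pullback.
Variables (R : realType).

Lemma is_pullback_comp m n p (M : charted R m) (N : charted R n)
    (P : charted R p) (f : M -> N) (g : N -> P) (omega : form_data M)
    (eta : form_data N) (theta : form_data P) :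
  chart_space M -> chart_space N ->
  (forall x, smooth_pt f x) -> (forall x, smooth_pt g x) ->
  is_pullback f eta omega -> is_pullback g theta eta ->
  is_pullback (g \o f) theta omega.
Proof.
move=> Mc Nc fs gs fE gE c e x cM eP cx ex /=; have [d dN dx] := Nc.2 (f x).
rewrite -/(jac _ _ _ _) (jac_comp Mc Nc (fs x) (gs (f x)) cM dN eP cx dx ex).
rewrite (fE c d x)// (gE d e (f x))//= -!/(jac _ _ _ _).
by rewrite trmx_mul !mulmxA.
Qed.

(** Both sides are [theta] read in a chart around g(f(x)), so the chain rule cancels the outer map.
    This passes the fiber condition from a configuration map to the form that it induces on [E]. *)
Lemma is_pullback_comp_left m n p (M : charted R m) (N : charted R n)
    (P : charted R p) (f : M -> N) (g : N -> P) (omega : form_data M)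
    (eta : form_data N) (theta : form_data P) :
  chart_space M -> chart_space N -> chart_space P ->
  (forall x, smooth_pt f x) -> (forall x, smooth_pt g x) ->
  is_pullback (g \o f) theta omega -> is_pullback g theta eta ->
  is_pullback f eta omega.
Proof.
move=> Mc Nc Pc fs gs fE gE c d x cM dN cx dx /=.
have [e eP ex] := Pc.2 (g (f x)).
rewrite (fE c e x)// (gE d e (f x))//= -!/(jac _ _ _ _).
rewrite (jac_comp Mc Nc (fs x) (gs (f x)) cM dN eP cx dx ex).
by rewrite trmx_mul !mulmxA.
Qed.

Lemma closed_formP n (M : charted R n) (omega : form_data M) :
  closed_form omega <-> forall c y, atlas M c -> chart_cod c y ->
    closed_at (fun z => omega c (chart_inv c z)) y.
Proof. by split=> cl c y cM cy i j k; exact: cl. Qed.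

Section closed_two_form_pullback.
Variables (m n : nat) (M : charted R m) (N : charted R n) (f : M -> N).
Variables (omega : form_data M) (eta : form_data N).
Hypotheses (Mm : is_manifold M) (Nc : chart_space N).
Hypotheses (fs : forall x, smooth_pt f x) (fE : is_pullback f eta omega).
Hypothesis (etaF : closed_two_form eta).
Let Mc := manifold_chart_space Mm.

Let near_pullback c d x : atlas M c -> atlas N d -> chart_dom c x ->
    chart_dom d (f x) ->
  {near c x, (fun y => jacobian (local_rep c d f) y
     *m eta d (chart_inv d (local_rep c d f y))
     *m (jacobian (local_rep c d f) y)^T) =1
   (fun y => omega c (chart_inv c y))}.
Proof.
move=> cM dN cx dx; have dch := Nc.1 _ dN; have [_ _ dK _ _] := dch.
have := near_chart (Mc.1 _ cM) cx ((fs x).1 _ (nbhs_chart_dom dch dx)).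
apply: filterS => y [fdy cy cyE].
by rewrite (fE cM dN cy fdy) /= cyE /local_rep dK.
Qed.

Let smooth_eta d z : atlas N d -> chart_dom d z ->
  smooth_at (fun y => eta d (chart_inv d y)) (d z).
Proof.
move=> dN dz; have [_ oc _ _ _] := Nc.1 _ dN.
have /Cinfty_onP := two_form_smooth etaF.1 dN.
by apply => //; exists z.
Qed.

(** [is_pullback] prescribes [omega] in every chart as J eta J^T, so each property is local and is
    read off this product; the chart of [N] may be changed from point to point. *)
Lemma closed_two_form_pullback : closed_two_form omega.
Proof.
split; first split.
- move=> c x cM cx; have [d dN dx] := Nc.2 (f x).
  rewrite (fE cM dN cx dx) /= !trmx_mul trmxK.
  by rewrite (two_form_alternating etaF.1 dN dx) mulNmx mulmxN mulmxA.
- move=> c cM; have [_ oc _ _ _] := Mc.1 _ cM.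
  apply/Cinfty_onP => // _ [x cx <-]; have [d dN dx] := Nc.2 (f x).
  have fcd := (fs x).2 _ _ cM dN cx dx.
  apply: near_eq_smooth_at (near_pullback cM dN cx dx) _.
  apply: smooth_at_mulmx; last exact/smooth_at_trmx/smooth_at_jacobian.
  apply: smooth_at_mulmx; first exact: smooth_at_jacobian.
  apply: (smooth_at_comp (g := fun z => eta d (chart_inv d z))) => //.
  by rewrite (local_rep_at f Mc d cM cx); exact: smooth_eta.
- move=> c d x cM dM cx dx /=; have [e eN ex] := Nc.2 (f x).
  rewrite (fE cM eN cx ex) (fE dM eN dx ex) /= -!/(jac _ _ _ _).
  rewrite (jac_changel Mm (fs x) cM dM eN cx dx ex).
  by rewrite trmx_mul !mulmxA.
apply/closed_formP => c _ cM [x cx <-]; have [d dN dx] := Nc.2 (f x).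
have fcd := (fs x).2 _ _ cM dN cx dx.
have fE' := local_rep_at f Mc d cM cx.
have [_ _ dK _ _] := Nc.1 _ dN.
apply: near_eq_closed_at (near_pullback cM dN cx dx) _.
apply: (closed_at_pullback (eta := fun z => eta d (chart_inv d z))) => //.
- by rewrite fE'; exact: smooth_eta.
- by rewrite fE' dK//; exact: (two_form_alternating etaF.1 dN dx).
- rewrite fE'; move/closed_formP: etaF.2; apply => //; by exists (f x).
Qed.

End closed_two_form_pullback.

(** The value at [x] needs some chart of [N] at f(x), which is chosen without any continuity in [x].
    The transition rule of [eta] makes the result independent of the choice. *)
Lemma pullback_exists m n (M : charted R m) (N : charted R n) (f : M -> N)
    (eta : form_data N) :
  chart_space M -> is_manifold N -> (forall x, smooth_pt f x) ->
  two_form eta -> exists omega : form_data M, is_pullback f eta omega.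
Proof.
move=> Mc Nm fs etaF; have Nc := manifold_chart_space Nm.
have [k kP] := choice (fun z => let: ex_intro2 c cN cz := Nc.2 z in
  ex_intro (fun c => atlas N c /\ chart_dom c z) c (conj cN cz)).
exists (fun c x => jac f c (k (f x)) x *m eta (k (f x)) (f x)
                   *m (jac f c (k (f x)) x)^T).
move=> c d x cM dN cx dx /=; have [kN kx] := kP (f x).
rewrite (two_form_transition etaF kN dN kx dx) /= -!/(jac _ _ _ _).
rewrite (jac_changer Mc Nm (fs x) cM kN dN cx kx dx).
by rewrite trmx_mul !mulmxA.
Qed.

End pullback.

(** * Products and bundles *)

Lemma open_setM (X Y : topologicalType) (A : set X) (B : set Y) :
  open A -> open B -> open (A `*` B).
Proof.
move=> oA oB; rewrite openE => -[x y] [Ax By]; exists (A, B) => //.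
by split; exact: open_nbhs_nbhs.
Qed.

Section continuity.
Variables (R : realType) (X : topologicalType).

Lemma continuous_mx m n (f : X -> 'M[R]_(m, n)) x :
  (forall i j, {for x, continuous (fun y => f y i j)}) ->
  {for x, continuous f}.
Proof.
move=> fc A [P nP PA].
have : \forall y \near x, forall ij : 'I_m * 'I_n, P ij.1 ij.2 (f y ij.1 ij.2).
  by apply: filter_forall => -[i j]; exact: fc (nP i j).
by apply: filterS => y Py; apply: PA => i j; exact: (Py (i, j)).
Qed.

Lemma continuous_coord m n (f : X -> 'M[R]_(m, n)) x i j :
  {for x, continuous f} -> {for x, continuous (fun y => f y i j)}.
Proof.
move=> fc.
apply: (@continuous_comp _ _ _ f (fun N : 'M[R]_(m, n) => N i j)) => //.
exact: coord_continuous.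
Qed.

Lemma continuous_mulmx m n p (f : X -> 'M[R]_(m, n)) (g : X -> 'M[R]_(n, p)) x :
  {for x, continuous f} -> {for x, continuous g} ->
  {for x, continuous (fun y => f y *m g y)}.
Proof.
move=> fc gc; apply: continuous_mx => i j.
have -> : (fun y => (f y *m g y) i j) = fun y => \sum_k f y i k * g y k j.
  by apply/funext => y; rewrite mxE.
elim: (index_enum _) => [|k r IH].
  have -> : (fun y => \sum_(k <- [::]) f y i k * g y k j) = fun=> 0.
    by apply/funext => y; rewrite big_nil.
  exact: cst_continuous.
have -> : (fun y => \sum_(k <- k :: r) f y i k * g y k j) =
    fun y => f y i k * g y k j + \sum_(k <- r) f y i k * g y k j.
  by apply/funext => y; rewrite big_cons.
apply: (@continuousD _ _ _ (fun y => f y i k * g y k j)) => //.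
by apply: continuousM; exact: continuous_coord.
Qed.

Lemma continuous_row_mx n1 n2 (f : X -> 'rV[R]_n1) (g : X -> 'rV[R]_n2) x :
  {for x, continuous f} -> {for x, continuous g} ->
  {for x, continuous (fun y => row_mx (f y) (g y))}.
Proof.
move=> fc gc; apply: continuous_mx => i j.
case: (split_ordP j) => k ->.
  have -> : (fun y => row_mx (f y) (g y) i (lshift n2 k)) = fun y => f y i k.
    by apply/funext => y; rewrite row_mxEl.
  exact: continuous_coord.
have -> : (fun y => row_mx (f y) (g y) i (rshift n1 k)) = fun y => g y i k.
  by apply/funext => y; rewrite row_mxEr.
exact: continuous_coord.
Qed.

(** [hausdorff_space] says that a cluster point of [nbhs x] equals [x]; this lemma carries the
    Hausdorff property back along continuous maps that jointly separate points. *)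
Lemma cluster_image (Y : topologicalType) (f : X -> Y) x x' :
  {for x, continuous f} -> {for x', continuous f} ->
  cluster (nbhs x) x' -> cluster (nbhs (f x)) (f x').
Proof.
move=> fx fx' xx' A A' Ax Ax'.
by have [y [Ay A'y]] := xx' _ _ (fx _ Ax) (fx' _ Ax'); exists (f y).
Qed.

End continuity.

Section product.
Variables (R : realType) (m n : nat) (M : charted R m) (N : charted R n).
Hypotheses (Mc : chart_space M) (Nc : chart_space N).

Lemma prod_chart_cod (X Y : Type) (c : chart R m X) (d : chart R n Y) :
  chart_cod (prod_chart c d) =
  [set z | chart_cod c (lsubmx z) /\ chart_cod d (rsubmx z)].
Proof.
apply/seteqP; split=> [_ [[x y] [/= cx dy] <-]|z [[x cx xz] [y dy yz]]] /=.
  by rewrite row_mxKl row_mxKr; split; [exists x|exists y].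
by exists (x, y) => //=; rewrite xz yz hsubmxK.
Qed.

Lemma is_chart_prod (X Y : topologicalType) (c : chart R m X)
    (d : chart R n Y) : is_chart c -> is_chart d -> is_chart (prod_chart c d).
Proof.
move=> [od oc cK cc ic] [od' oc' dK dc id].
split=> [||[x y] [/= cx dy]|[x y] [/= cx dy]|z].
- exact: open_setM.
- rewrite prod_chart_cod; apply: openI.
    apply: (open_comp (f := lsubmx)) => // z _; exact: continuous_lsubmx.
  apply: (open_comp (f := rsubmx)) => // z _; exact: continuous_rsubmx.
- by rewrite row_mxKl row_mxKr cK// dK.
- apply: (@continuous_row_mx _ _ _ _ (c \o fst) (d \o snd)).
    by apply: continuous_comp; [exact: cvg_fst|exact: cc].
  by apply: continuous_comp; [exact: cvg_snd|exact: dc].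
rewrite prod_chart_cod => -[cz dz].
have icz : {for z, continuous (chart_inv c \o lsubmx)}.
  by apply: continuous_comp; [exact: continuous_lsubmx|exact: ic].
have idz : {for z, continuous (chart_inv d \o rsubmx)}.
  by apply: continuous_comp; [exact: continuous_rsubmx|exact: id].
exact: cvg_pair icz idz.
Qed.

Lemma chart_space_prod : chart_space (prod_charted M N).
Proof.
split=> [_ [c [d [cM dN ->]]]|[x y]].
  by apply: is_chart_prod; [exact: Mc.1|exact: Nc.1].
have [c cM cx] := Mc.2 x; have [d dN dy] := Nc.2 y.
by exists (prod_chart c d); [exists c, d|].
Qed.

Lemma atlas_prod c d : atlas M c -> atlas N d ->
  atlas (prod_charted M N) (prod_chart c d).
Proof. by move=> cM dN; exists c, d. Qed.

Definition pair_with (x : M) : N -> prod_charted M N := fun y => (x, y).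

Lemma smooth_pt_pair_with x y : is_manifold N -> smooth_pt (pair_with x) y.
Proof.
move=> Nm; split; first by apply: cvg_pair; [exact: cvg_cst|exact: cvg_id].
move=> d _ dN [c [d' [cM d'N ->]]] dy [/= cx d'y].
apply: (@smooth_at_row_mx _ _ _ _ _ (fun=> c x) (local_rep d d' id)).
  exact: smooth_at_cst.
exact: (smooth_pt_id y Nm).2.
Qed.

Lemma jac_pair_with x y c d : atlas M c -> atlas N d ->
  chart_dom c x -> chart_dom d y ->
  jac (pair_with x) d (prod_chart c d) y = row_mx 0 1%:M.
Proof.
move=> cM dN cx dy; rewrite -(jacobian_cst (c x) (d y)) -(jacobian_id (d y)).
rewrite -jacobian_row_mx; [|exact: smooth_at_cst|exact: smooth_at_id].
apply/esym/near_eq_jacobian.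
  have := near_chart (Nc.1 _ dN) dy (@filterT _ _ (nbhs_filter y)).
  by apply: filterS => z [_ _ dz]; rewrite /local_rep /= dz.
apply: smooth_at_differentiable.
by apply: smooth_at_row_mx; [exact: smooth_at_cst|exact: smooth_at_id].
Qed.

Definition prod_fst (z : prod_charted M N) : M := z.1.

Lemma smooth_pt_fst z : is_manifold M -> smooth_pt prod_fst z.
Proof.
move=> Mm; split; first exact: cvg_fst.
move=> _ c' [c [d [cM dN ->]]] c'M [/= cx dy] c'x.
apply: (@smooth_at_comp _ _ _ _ _ lsubmx (local_rep c c' id)).
  exact: smooth_at_lsubmx.
by rewrite row_mxKl; exact: (smooth_pt_id z.1 Mm).2.
Qed.

Lemma jac_fst z c d : atlas M c -> atlas N d ->
  chart_dom c z.1 -> chart_dom d z.2 ->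
  jac prod_fst (prod_chart c d) c z = col_mx 1%:M 0.
Proof.
move=> cM dN cz dz; rewrite -(jacobian_lsubmx (row_mx (c z.1) (d z.2))).
apply/esym/near_eq_jacobian.
  have cdz : chart_dom (prod_chart c d) z by [].
  have := near_chart (is_chart_prod (Mc.1 _ cM) (Nc.1 _ dN)) cdz
    (@filterT _ _ (nbhs_filter z)).
  apply: filterS => u [_ _ uE].
  by rewrite -[in LHS]uE /local_rep /= row_mxKl.
exact/smooth_at_differentiable/smooth_at_lsubmx.
Qed.

End product.

Lemma mul_row01_mx (R : pzRingType) n1 n2 k (A : 'M[R]_(n1 + n2, k)) :
  row_mx 0 1%:M *m A = dsubmx A.
Proof. by rewrite -{1}[A]vsubmxK mul_row_col mul0mx mul1mx add0r. Qed.

(** * Local trivializations of the bundle in coordinates *)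

Section bundle.
Variables (R : realType) (m b e : nat).
Variables (M : charted R m) (B : charted R b) (E : charted R e).
Variables (omega : form_data M) (p : E -> B) (T : set (triv M B E)).
Hypotheses (Mm : is_manifold M) (bundleE : symplectic_bundle omega p T).
Let Mc := manifold_chart_space Mm.
Let Bm := bundle_base bundleE.
Let Bc := manifold_chart_space Bm.
Let Em := bundle_total bundleE.
Let Ec := manifold_chart_space Em.
Let BMc := chart_space_prod Bc Mc.

Lemma smooth_pt_proj x : smooth_pt p x.
Proof. by have /smooth_mapP := bundle_proj bundleE; apply. Qed.

Lemma open_proj_preimage (A : set B) : open A -> open (p @^-1` A).
Proof.
by move=> oA; apply: open_comp => // x _; exact: (smooth_pt_proj x).1.
Qed.

Section trivialization.
Variable t : triv M B E.
Hypothesis Tt : T t.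

Lemma open_triv_dom : open (triv_dom t).
Proof. by have [] := bundle_triv bundleE Tt. Qed.

Lemma open_triv_prod : open (triv_dom t `*` [set: M]).
Proof. by apply: open_setM; [exact: open_triv_dom|exact: openT]. Qed.

Lemma smooth_pt_triv_fun x : triv_dom t (p x) ->
  @smooth_pt _ _ _ E (prod_charted B M) (triv_fun t) x.
Proof.
have [_ [+ _ _ _] _] := bundle_triv bundleE Tt.
move=> /smooth_onP; apply => //.
exact/open_proj_preimage/open_triv_dom.
Qed.

Lemma smooth_pt_triv_inv z : triv_dom t z.1 ->
  @smooth_pt _ _ _ (prod_charted B M) E (triv_inv t) z.
Proof.
have [_ [_ + _ _] _] := bundle_triv bundleE Tt.
by move=> /smooth_onP H tz; apply: H => //; exact: open_triv_prod.
Qed.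

Lemma triv_funK x : triv_dom t (p x) -> triv_inv t (triv_fun t x) = x.
Proof.
by have [_ [_ _ H _] _] := bundle_triv bundleE Tt; move=> /H[].
Qed.

Lemma triv_invK z : triv_dom t z.1 -> triv_fun t (triv_inv t z) = z.
Proof.
have [_ [_ _ _ H] _] := bundle_triv bundleE Tt.
by case: z => y x /= ty; have [|_ ->] := H (y, x).
Qed.

Lemma triv_fun_fst x : triv_dom t (p x) -> (triv_fun t x).1 = p x.
Proof. by have [_ _] := bundle_triv bundleE Tt; apply. Qed.

Lemma proj_triv_inv z : triv_dom t z.1 -> p (triv_inv t z) = z.1.
Proof.
have [_ [_ _ _ H] _] := bundle_triv bundleE Tt.
case: z => y x /= ty; have [|tp E1] := H (y, x); first by [].
by rewrite -triv_fun_fst// E1.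
Qed.

Lemma fiber_paramE y : fiber_param t y = triv_inv t \o @pair_with _ _ _ B M y.
Proof. by []. Qed.

Lemma smooth_pt_fiber_param y x : triv_dom t y ->
  smooth_pt (fiber_param t y) x.
Proof.
move=> ty; rewrite fiber_paramE.
apply: smooth_pt_comp => //; first exact: smooth_pt_pair_with.
exact: smooth_pt_triv_inv.
Qed.

(** The fiber is a slice of the product, and the inclusion of the slice has Jacobian [0, 1];
    multiplying by it keeps the bottom rows. *)
Lemma jac_fiber_param y z d a c : triv_dom t y ->
  atlas B d -> chart_dom d y -> atlas M a -> chart_dom a z ->
  atlas E c -> chart_dom c (fiber_param t y z) ->
  jac (fiber_param t y) a c z =
  dsubmx (@jac _ _ _ (prod_charted B M) E (triv_inv t) (prod_chart d a) c
            (y, z)).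
Proof.
move=> ty dB dy aM az cE cx.
have psm : smooth_pt (@pair_with _ _ _ B M y) z by exact: smooth_pt_pair_with.
have ism : @smooth_pt _ _ _ (prod_charted B M) E (triv_inv t) (y, z).
  exact: smooth_pt_triv_inv.
have daz : chart_dom (prod_chart d a) (y, z) by [].
have E1 := jac_comp Mc BMc psm ism aM (atlas_prod dB aM) cE az daz cx.
have E2 := jac_pair_with Mc dB aM dy az.
pose F := @jac _ _ _ (prod_charted B M) E (triv_inv t) (prod_chart d a) c
  (y, z).
exact: (eq_trans E1 (eq_trans (congr1 (fun X => X *m F) E2) (mul_row01_mx F))).
Qed.

End trivialization.

(* In product coordinates around x, the matrices F and G are the mutually
   inverse Jacobians of a local trivialization and of its inverse. *)
Lemma vertical_splitting x c d : atlas E c -> atlas B d ->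
  chart_dom c x -> chart_dom d (p x) ->
  exists t y a z (F : 'M[R]_(b + m, e)) (G : 'M[R]_(e, b + m)),
    [/\ T t /\ triv_dom t y, atlas M a /\ chart_dom a z,
        fiber_param t y z = x, F *m G = 1%:M /\ G *m F = 1%:M &
        jac p c d x = lsubmx G /\ jac (fiber_param t y) a c z = dsubmx F].
Proof.
move=> cE dB cx dx; have [t Tt tx] := bundle_cover bundleE (p x).
have [a aM az] := Mc.2 (triv_fun t x).2.
have fx1 := triv_fun_fst Tt tx; have fK := triv_funK Tt tx.
have dax : chart_dom (prod_chart d a) (triv_fun t x) by split; rewrite /= ?fx1.
have daA := atlas_prod dB aM.
have tx' : triv_dom t (triv_fun t x).1 by rewrite fx1.
have fsm := smooth_pt_triv_fun Tt tx.
have ism := smooth_pt_triv_inv Tt tx'.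
have fK' : fiber_param t (p x) (triv_fun t x).2 = x.
  by rewrite /fiber_param -fx1 -surjective_pairing.
exists t, (p x), a, (triv_fun t x).2.
exists (@jac _ _ _ (prod_charted B M) E (triv_inv t) (prod_chart d a) c
  (triv_fun t x)).
exists (@jac _ _ _ E (prod_charted B M) (triv_fun t) c (prod_chart d a) x).
split=> //.
- split.
    have fsm' : @smooth_pt _ _ _ E (prod_charted B M) (triv_fun t)
       (triv_inv t (triv_fun t x)) by rewrite fK.
    have := jac_comp BMc Ec ism fsm' daA cE daA dax.
    rewrite fK => /(_ cx dax) <-.
    rewrite -(jac_id BMc daA dax); apply: near_eq_jac => //; rewrite /= ?fK //.
      have := open_nbhs_nbhs (conj (open_triv_prod Tt) (conj tx' I)).
      by apply: filterS => z' [tz' _]; exact: triv_invK.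
    exact: smooth_pt_comp.
  have := jac_comp Ec BMc fsm ism cE daA cE cx dax.
  rewrite fK => /(_ cx) <-.
  rewrite -(jac_id Ec cE cx); apply: near_eq_jac => //; rewrite /= ?fK //.
    have := open_nbhs_nbhs (conj (open_proj_preimage (open_triv_dom Tt)) tx).
    by apply: filterS => x'; exact: triv_funK.
  exact: smooth_pt_comp Ec BMc fsm ism.
split.
  (* Near [x] the projection is the first component of the trivialization, so its Jacobian is [G]
     times the column block [1; 0]. *)
  have fsm1 : smooth_pt (@prod_fst _ _ _ B M) (triv_fun t x).
    exact: smooth_pt_fst.
  have dfx : chart_dom d (triv_fun t x).1 by rewrite fx1.
  have E1 := jac_comp Ec BMc fsm fsm1 cE daA dB cx dax dfx.
  rewrite (jac_fst Bc Mc dB aM dfx az) in E1.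
  rewrite -[X in _ = X *m _]hsubmxK mul_row_col mulmx1 mulmx0 addr0 in E1.
  rewrite -{}E1.
  apply: near_eq_jac => //; last exact: smooth_pt_proj.
  have := open_nbhs_nbhs (conj (open_proj_preimage (open_triv_dom Tt)) tx).
  by apply: filterS => x' tx''; rewrite /= /prod_fst triv_fun_fst.
have zE : (p x, (triv_fun t x).2) = triv_fun t x.
  by rewrite -fx1 -surjective_pairing.
have cx' : chart_dom c (fiber_param t (p x) (triv_fun t x).2) by rewrite fK'.
have JE := jac_fiber_param Tt tx dB dx aM az cE cx'.
by rewrite zE in JE.
Qed.

End bundle.

(** * The pullback of the cotangent bundle *)

(* A covector at p (cv_base), given by its coordinates in the chart s selects
   at this point. The choice of s need not be continuous, so the topology is
   not that of the product; it is defined below by requiring the coordinate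
   parametrizations of_coord d to be continuous for all charts d. *)
Record covector (R : realType) b e (B : charted R b) (E : charted R e)
    (p : E -> B) (s : B -> chart R b B) :=
  Covector { cv_base : E; cv_coef : 'rV[R]_b }.

HB.instance Definition _ R b e B E p s :=
  gen_eqMixin (@covector R b e B E p s).
HB.instance Definition _ R b e B E p s :=
  gen_choiceMixin (@covector R b e B E p s).

Section covector_topology.
Variables (R : realType) (b e : nat) (B : charted R b) (E : charted R e).
Variables (p : E -> B) (s : B -> chart R b B).
Local Notation W := (covector p s).

(* A covector eta pairs with a tangent vector v as eta *m v^T, so that the
   coordinates of covectors change by the transpose of the Jacobian of the
   inverse transition. *)
Definition covector_change (d d' : chart R b B) (y : B) : 'M[R]_b :=
  (jac id d' d y)^T.

Definition of_coord (d : chart R b B) (z : E * 'rV[R]_b) : W :=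
  Covector p s z.1 (z.2 *m covector_change d (s (p z.1)) (p z.1)).

Definition to_coord (d : chart R b B) (w : W) : 'rV[R]_b :=
  cv_coef w *m covector_change (s (p (cv_base w))) d (p (cv_base w)).

Definition covector_open : set_system W := [set A |
  forall d z, atlas B d -> chart_dom d (p z.1) -> A (of_coord d z) ->
    nbhs z (of_coord d @^-1` A)].

Lemma covector_openT : covector_open setT.
Proof. by move=> d z _ _ _; exact: filterT. Qed.

Lemma covector_openI : setI_closed covector_open.
Proof.
move=> A A' oA oA' d z dB dz [Az A'z].
by apply: filterI; [exact: oA|exact: oA'].
Qed.

Lemma covector_open_bigU (I : Type) (f : I -> set W) :
  (forall i, covector_open (f i)) -> covector_open (\bigcup_i f i).
Proof.
move=> of_ d z dB dz [i _ fiz]; apply: filterS (of_ i d z dB dz fiz).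
by move=> z' ?; exists i.
Qed.

HB.instance Definition _ := isOpenTopological.Build W
  covector_openT covector_openI covector_open_bigU.

End covector_topology.

Definition cov_chart (R : realType) b e (B : charted R b) (E : charted R e)
    (p : E -> B) (s : B -> chart R b B) (c : chart R e E) (d : chart R b B) :
    chart R (e + b) (covector p s) :=
  {| chart_dom :=
       [set w | chart_dom c (cv_base w) /\ chart_dom d (p (cv_base w))];
     chart_fun := fun w => row_mx (c (cv_base w)) (to_coord d w);
     chart_inv := fun y => of_coord p s d (chart_inv c (lsubmx y), rsubmx y) |}.

Definition cov_charted (R : realType) b e (B : charted R b) (E : charted R e)
    (p : E -> B) (s : B -> chart R b B) : charted R (e + b) :=
  {| charted_space := covector p s : topologicalType;
     atlas := [set k | exists c d,
       [/\ atlas E c, atlas B d & k = cov_chart p s c d]] |}.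

(** The basis consists of the balls with rational centers and radii 1/(k+1). *)
Lemma second_countable_rV (R : realType) n : @second_countable 'rV[R]_n.
Proof.
pose bs (u : 'rV[rat]_n * nat) : set 'rV[R]_n :=
  ball (map_mx (ratr : rat -> R) u.1) (u.2.+1%:R^-1).
exists (range bs).
  exact: sub_countable (card_image_le _ _) (countableP _).
split=> [_ [u _ <-]|x A /nbhs_ballP[r /= r0 xA]]; first exact: ball_open.
(* Half of [r] is enough room: a ball of this radius that contains [x] lies in the ball of radius
   [r] around [x]. *)
have [k kr] : exists k : nat, k.+1%:R^-1 < r / 2.
  have := near_infty_natSinv_lt (PosNum (divr_gt0 r0 (ltr0n R 2))).
  by move=> [k _ /(_ k (leqnn k))]; exists k.
have k0 : 0 < k.+1%:R^-1 :> R by rewrite invr_gt0.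
have /choice[q qP] : forall i, exists q : rat,
    ball (x 0 i) k.+1%:R^-1 (ratr q : R).
  move=> i; have /rat_in_itvoo[q /itvP qx] : x 0 i < x 0 i + k.+1%:R^-1.
    by rewrite ltrDl.
  exists q; rewrite /ball /= distrC ltr_distl qx andbT.
  by rewrite (@lt_trans _ _ (x 0 i)) ?qx// ltrBlDl ltrDr.
have xq : ball (map_mx (ratr : rat -> R) (\row_i q i)) k.+1%:R^-1 x.
  by split=> // i j; rewrite !mxE ord1; apply: ball_sym; exact: qP.
exists (bs (\row_i q i, k)); first by split; [exists (\row_i q i, k)|].
move=> y qy; apply: xA.
apply: (@le_ball _ _ _ (k.+1%:R^-1 + k.+1%:R^-1)).
  by rewrite (splitr r) ltW// ltrD.
exact: ball_triangle (ball_sym xq) qy.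
Qed.

(** * Topology and charts of the bundle of covectors *)

Section covector_manifold.
Variables (R : realType) (b e : nat) (B : charted R b) (E : charted R e).
Variables (p : E -> B) (s : B -> chart R b B).
Hypotheses (Bm : is_manifold B) (Em : is_manifold E).
Hypotheses (psm : forall x, smooth_pt p x).
Hypotheses (sP : forall y, atlas B (s y) /\ chart_dom (s y) y).
Local Notation W := (cov_charted p s).
Let Bc := manifold_chart_space Bm.
Let Ec := manifold_chart_space Em.

Lemma covector_change_id d y : atlas B d -> chart_dom d y ->
  covector_change d d y = 1%:M.
Proof. by move=> dB dy; rewrite /covector_change jac_id// trmx1. Qed.

(** The cocycle rule is the chain rule for transition maps; transposition reverses the order of the
    factors, as the action on rows from the right requires. *)
Lemma covector_change_comp d d' d'' y :
  atlas B d -> atlas B d' -> atlas B d'' ->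
  chart_dom d y -> chart_dom d' y -> chart_dom d'' y ->
  covector_change d d' y *m covector_change d' d'' y = covector_change d d'' y.
Proof.
move=> dB d'B d''B dy d'y d''y; rewrite /covector_change -trmx_mul.
by rewrite -(jac_changel Bm (smooth_pt_id y Bm) d''B d'B dB).
Qed.

Lemma continuous_covector_change d d' y : atlas B d -> atlas B d' ->
  chart_dom d y -> chart_dom d' y -> {for y, continuous (covector_change d d')}.
Proof.
move=> dB d'B dy d'y; have [_ _ _ cd _] := Bc.1 _ d'B.
apply: (@continuous_comp _ _ _ d'
  (fun z => (jacobian (local_rep d' d id) z)^T)).
  exact: cd.
apply: smooth_at_continuous; apply/smooth_at_trmx/smooth_at_jacobian.
exact: (smooth_pt_id y Bm).2.
Qed.

(** The chart selected by [s] occurs once as target and once as source of a coordinate change and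
    cancels by the cocycle rule. *)
Lemma to_of_coord d d' x eta : atlas B d -> atlas B d' ->
  chart_dom d (p x) -> chart_dom d' (p x) ->
  to_coord d' (of_coord p s d (x, eta)) = eta *m covector_change d d' (p x).
Proof.
move=> dB d'B dx d'x; have [sB sx] := sP (p x).
by rewrite /to_coord /= -mulmxA covector_change_comp.
Qed.

Lemma of_to_coord d (w : W) : atlas B d -> chart_dom d (p (cv_base w)) ->
  of_coord p s d (cv_base w, to_coord d w) = w.
Proof.
move=> dB dw; have [sB sx] := sP (p (cv_base w)).
rewrite /of_coord /to_coord /= -mulmxA covector_change_comp//.
by rewrite covector_change_id// mulmx1; case: w dw sB sx.
Qed.

Lemma covector_open_nbhs (A : set W) w : covector_open A -> A w -> nbhs w A.
Proof. by move=> oA Aw; exists A; split. Qed.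

Lemma continuous_cv_base : continuous (@cv_base _ _ _ B E p s : W -> E).
Proof.
move=> w A; rewrite nbhsE => -[U [oU Uw] UA].
apply: (@filterS _ _ _ (@cv_base _ _ _ B E p s @^-1` U)).
  by move=> w' /UA.
apply: covector_open_nbhs => // d z dB dz Uz.
exact: cvg_fst (open_nbhs_nbhs (conj oU Uz)).
Qed.

Lemma continuous_of_coord d z : atlas B d -> chart_dom d (p z.1) ->
  {for z, continuous (of_coord p s d : _ -> W)}.
Proof.
move=> dB dz A [U [oU Uz UA]]; apply: filterS (oU d z dB dz Uz).
by move=> z' /UA.
Qed.

Lemma continuous_to_coord d w : atlas B d -> chart_dom d (p (cv_base w)) ->
  {for w, continuous (to_coord d : W -> 'rV[R]_b)}.
Proof.
move=> dB dw A; rewrite nbhsE => -[V [oV Vw] VA].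
(* The condition on the base point is part of the set because openness is tested in every chart
   [d'], while the change of coordinates is continuous only where both charts are defined. *)
apply: (@filterS _ _ _
  [set w' : W | chart_dom d (p (cv_base w')) /\ V (to_coord d w')]).
  by move=> w' [_ /VA].
apply: covector_open_nbhs => // d' [x eta] d'B /= d'x [dx Vx].
rewrite to_of_coord// in Vx.
have pc : {for (x, eta), continuous (p \o fst)}.
  by apply: continuous_comp; [exact: cvg_fst|exact: (psm _).1].
have gc : {for (x, eta), continuous
    (fun z : E * 'rV[R]_b => z.2 *m covector_change d' d (p z.1))}.
  apply: continuous_mulmx; first exact: cvg_snd.
  exact: (continuous_comp pc (continuous_covector_change d'B dB d'x dx)).
have N1 : nbhs (x, eta) (fun z : E * 'rV[R]_b =>
    V (z.2 *m covector_change d' d (p z.1))).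
  exact: gc (open_nbhs_nbhs (conj oV Vx)).
have N2 : nbhs (x, eta) (fun z => chart_dom d (p z.1)) :=
  pc _ (nbhs_chart_dom (Bc.1 _ dB) dx).
have N3 : nbhs (x, eta) (fun z => chart_dom d' (p z.1)) :=
  pc _ (nbhs_chart_dom (Bc.1 _ d'B) d'x).
have FF : Filter (nbhs (x, eta)).
  exact: (@nbhs_filter (E * 'rV[R]_b)%type (x, eta)).
apply: filterS (filterI (filterI N1 N2) N3).
move=> -[x' eta'] [[/= V' dx'] d'x']; split; first exact: dx'.
by rewrite to_of_coord.
Qed.

(** Covectors are separated by their base points or, over a common base point, by their coordinates
    in one chart. *)
Lemma hausdorff_covector : hausdorff_space W.
Proof.
move=> w w' ww'.
have ee : cv_base w = cv_base w'.
  apply: (manifold_hausdorff Em).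
  by apply: cluster_image ww'; exact: continuous_cv_base.
have [d dB dw] := Bc.2 (p (cv_base w)); have dw' := dw; rewrite ee in dw'.
suff tE : to_coord d w = to_coord d w'.
  apply: (eq_trans (esym (of_to_coord dB dw))).
  by apply: (eq_trans _ (of_to_coord dB dw')); rewrite tE ee.
apply: (@norm_hausdorff _ 'rV[R]_b).
by apply: cluster_image ww'; exact: continuous_to_coord.
Qed.

(** The atlas of [B] need not be countable. One chart is therefore fixed for each basic open set
    [U0] of [E] that maps into some chart domain, and the basis is indexed by [U0] together with
    basic open sets for the base point and for the coordinates in that chart. *)
Lemma second_countable_covector : @second_countable W.
Proof.
have [BE cBE [oBE bBE]] := manifold_second_countable Em.
have [BV cBV [oBV bBV]] := second_countable_rV R b.
pose good U0 (A : set E -> set 'rV[R]_b -> set W) := exists d,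
  [/\ atlas B d, U0 `<=` p @^-1` chart_dom d &
      A = fun U V =>
        [set w | [/\ U0 (cv_base w), U (cv_base w) & V (to_coord d w)]]].
have /choice[D DP] : forall U0, exists A, (exists A', good U0 A') -> good U0 A.
  move=> U0; have [[A gA]|ng] := pselect (exists A', good U0 A').
    by exists A.
  (* A default for those [U0] over which no single chart is defined; the index set [I] excludes
     them. *)
  by exists (fun _ _ => set0) => /ng.
pose I := [set t | [/\ BE t.1, exists A, good t.1 A, BE t.2.1 & BV t.2.2]].
exists ((fun t => D t.1 t.2.1 t.2.2) @` I).
  apply: sub_countable (card_image_le _ _) _.
  apply: (@sub_countable _ _ _ (BE `*` (BE `*` BV))).
    by apply: subset_card_le => -[U0 [U V]] [].
  by apply: countableX => //; exact: countableX.
split.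
  move=> _ [[U0 [U V]] [/= U0B gU0 UB VB] <-].
  have [d [dB U0d ->]] := DP _ gU0; rewrite openE => w [U0w Uw Vw].
  have N0 : nbhs w (fun w' : W => U0 (cv_base w')).
    exact: continuous_cv_base (open_nbhs_nbhs (conj (oBE _ U0B) U0w)).
  have N1 : nbhs w (fun w' : W => U (cv_base w')).
    exact: continuous_cv_base (open_nbhs_nbhs (conj (oBE _ UB) Uw)).
  have N2 : nbhs w (fun w' : W => V (to_coord d w')).
    have tc := continuous_to_coord dB (U0d _ U0w).
    exact: tc (open_nbhs_nbhs (conj (oBV _ VB) Vw)).
  apply: filterS (filterI (filterI N0 N1) N2) => w' [[U0w' Uw'] Vw'].
  by split.
move=> w A Aw; have [d dB dw] := Bc.2 (p (cv_base w)).
have pd := (psm (cv_base w)).1 _ (nbhs_chart_dom (Bc.1 _ dB) dw).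
have [U0 [U0B U0w] U0d] := bBE _ _ pd.
have gU0 : exists A', good U0 A' by eexists; exists d.
(* The chart [d] only shows that [U0] lies over some chart domain; the basic sets use the chart [d']
   that was fixed for [U0]. *)
have [d' [d'B U0d' DE]] := DP _ gU0.
have := Aw; rewrite -{1}(of_to_coord d'B (U0d' _ U0w)).
have dw' : chart_dom d' (p (cv_base w, to_coord d' w).1) by exact: U0d'.
move=> /(continuous_of_coord d'B dw').
move=> [[A1 A2] /= [/bBE[U [UB Uw] UA1] /bBV[V [VB Vw] VA2]] A12].
exists (D U0 U V).
  split; first by exists (U0, (U, V)).
  by rewrite DE.
rewrite DE => w' [U0w' Uw' Vw'].
rewrite -(of_to_coord d'B (U0d' _ U0w')).
by apply: (A12 (_, _)); split; [exact: UA1|exact: VA2].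
Qed.

Lemma is_chart_cov c d : atlas E c -> atlas B d ->
  is_chart (cov_chart p s c d : chart R (e + b) W).
Proof.
move=> cE dB; have [oc occ cK cc ic] := Ec.1 _ cE.
have odd : open (p @^-1` chart_dom d).
  apply: open_comp => [x _|]; first exact: (psm x).1.
  by have [] := Bc.1 _ dB.
have cod : chart_cod (cov_chart p s c d) =
    [set y | chart_cod c (lsubmx y) /\
             chart_dom d (p (chart_inv c (lsubmx y)))].
  apply/seteqP; split=> [_ [w [/= cw dw] <-]|y [[x cx xE] /= dy]].
    by rewrite row_mxKl cK//; split=> //; exists (cv_base w).
  exists (of_coord p s d (x, rsubmx y)).
    by split=> //=; move: dy; rewrite -xE cK.
  rewrite /= to_of_coord//; last 2 first.
  - by move: dy; rewrite -xE cK.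
  - by move: dy; rewrite -xE cK.
  rewrite covector_change_id ?mulmx1 ?xE ?hsubmxK//.
  by move: dy; rewrite -xE cK.
split.
- rewrite openE => w [/= cw dw].
  have N := open_nbhs_nbhs (conj (openI oc odd) (conj cw dw)).
  exact: (@continuous_cv_base w _ N).
- rewrite cod openE => y [cy dy].
  have lc := @continuous_lsubmx R 1 e b y.
  have N1 := open_nbhs_nbhs (conj occ cy).
  have N2 := ic _ cy _ (open_nbhs_nbhs (conj odd dy)).
  exact: lc (filterI N1 N2).
- by move=> w [/= cw dw]; rewrite row_mxKl row_mxKr cK// of_to_coord.
- move=> w [/= cw dw].
  apply: continuous_row_mx; last exact: continuous_to_coord.
  exact: (continuous_comp (@continuous_cv_base w) (cc _ cw)).
rewrite cod => y [cy dy].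
have zc : {for y, continuous (fun y => (chart_inv c (lsubmx y), rsubmx y))}.
  have icy : {for y, continuous (chart_inv c \o lsubmx)}.
    by apply: continuous_comp; [exact: continuous_lsubmx|exact: ic].
  exact: cvg_pair icy (@continuous_rsubmx R 1 e b y).
apply: (@continuous_comp _ _ _ _ (of_coord p s d : _ -> W)).
  exact: zc.
exact: continuous_of_coord.
Qed.

Lemma chart_space_covector : chart_space W.
Proof.
split=> [_ [c [d [cE dB ->]]]|w]; first exact: is_chart_cov.
have [c cE cw] := Ec.2 (cv_base w); have [d dB dw] := Bc.2 (p (cv_base w)).
by exists (cov_chart p s c d); [exists c, d|].
Qed.

End covector_manifold.

(** * The symplectic form on the pulled back cotangent bundle *)

Section calculus.
Variable R : realType.

(** Transition maps of the bundle of covectors have this shape: the fiber coordinate enters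
    linearly, with a matrix that depends on the base point. *)
Lemma smooth_at_affine n k l q (tau : 'rV[R]_n -> 'rV[R]_k)
    (g : 'rV[R]_n -> 'M[R]_(l, q)) z eta : smooth_at tau z -> smooth_at g z ->
  smooth_at (fun y : 'rV[R]_(n + l) =>
    row_mx (tau (lsubmx y)) (rsubmx y *m g (lsubmx y))) (row_mx z eta).
Proof.
move=> ts gs; have ls := @smooth_at_lsubmx R 1 n l (row_mx z eta).
apply: smooth_at_row_mx.
  by apply: (smooth_at_comp (g := tau) ls); rewrite row_mxKl.
apply: smooth_at_mulmx; first exact: smooth_at_rsubmx.
by apply: (smooth_at_comp (g := g) ls); rewrite row_mxKl.
Qed.

Lemma jacobian_affine n k l q (tau : 'rV[R]_n -> 'rV[R]_k)
    (g : 'rV[R]_n -> 'M[R]_(l, q)) z eta : smooth_at tau z -> smooth_at g z ->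
  jacobian (fun y : 'rV[R]_(n + l) =>
    row_mx (tau (lsubmx y)) (rsubmx y *m g (lsubmx y))) (row_mx z eta) =
  block_mx (jacobian tau z) (jacobian (fun z => eta *m g z) z) 0 (g z).
Proof.
move=> ts gs; have ls := @smooth_at_lsubmx R 1 n l (row_mx z eta).
have ts' : smooth_at tau (lsubmx (row_mx z eta)) by rewrite row_mxKl.
have gs' : smooth_at g (lsubmx (row_mx z eta)) by rewrite row_mxKl.
have Hs : smooth_at (fun y : 'rV[R]_(n + l) => rsubmx y *m g (lsubmx y))
    (row_mx z eta).
  apply: smooth_at_mulmx; first exact: smooth_at_rsubmx.
  exact: (smooth_at_comp (g := g) ls gs').
have dH := smooth_at_differentiable Hs.
rewrite (jacobian_row_mx (smooth_at_comp ls ts') Hs) block_mxEh; congr row_mx.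
  apply: (eq_trans (jacobian_comp (smooth_at_differentiable ls)
                     (smooth_at_differentiable ts'))).
  by rewrite jacobian_lsubmx row_mxKl mul_col_mx mul1mx mul0mx.
(* The two row blocks are Jacobians along slices: first [eta] is held fixed, then [z]. *)
rewrite -[LHS]vsubmxK; congr col_mx.
  have is1 : smooth_at (fun z => row_mx z eta) z.
    by apply: smooth_at_row_mx; [exact: smooth_at_id|exact: smooth_at_cst].
  have := jacobian_comp (smooth_at_differentiable is1) dH.
  rewrite (jacobian_row_mx (smooth_at_id z) (smooth_at_cst eta z)).
  rewrite jacobian_id jacobian_cst -[X in _ = _ *m X]vsubmxK.
  rewrite mul_row_col mul1mx mul0mx addr0 => <-; congr jacobian.
  by apply/funext => y /=; rewrite row_mxKl row_mxKr.
have is2 : smooth_at (fun eta => row_mx z eta) eta.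
  by apply: smooth_at_row_mx; [exact: smooth_at_cst|exact: smooth_at_id].
have := jacobian_comp (smooth_at_differentiable is2) dH.
rewrite (jacobian_row_mx (smooth_at_cst z eta) (smooth_at_id eta)).
rewrite jacobian_id jacobian_cst -[X in _ = _ *m X]vsubmxK.
rewrite mul_row_col mul1mx mul0mx add0r => <-.
rewrite -[RHS](jacobian_mulmxr _ eta); congr jacobian.
by apply/funext => y /=; rewrite row_mxKl row_mxKr.
Qed.

(** [S] is the Hessian of the scalar function obtained by pairing [f] with the constant covector
    [eta]. *)
Lemma jacobian_row_jacobian_sym n k (f : 'rV[R]_n -> 'rV[R]_k) eta u :
  smooth_at f u ->
  let S := jacobian (fun v => eta *m (jacobian f v)^T) u in S^T = S.
Proof.
move=> fu S; pose h v := f v *m eta^T.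
have mulE (v : 'rV[R]_k) : smooth_at (fun v => v *m eta^T) v.
  by apply: smooth_at_mulmx; [exact: smooth_at_id|exact: smooth_at_cst].
have hu : smooth_at h u by exact: (smooth_at_comp fu (mulE _)).
have hE : {near u, (fun v => eta *m (jacobian f v)^T) =1
    (fun v => (jacobian h v)^T)}.
  apply: filterS (near_smooth_at fu) => v fv.
  have -> : jacobian h v = jacobian f v *m eta^T.
    apply: (eq_trans (jacobian_comp (smooth_at_differentiable fv)
                       (smooth_at_differentiable (mulE (f v))))).
    by rewrite jacobian_mulmxr.
  by rewrite trmx_mul trmxK.
have Ss : smooth_at (fun v => eta *m (jacobian f v)^T) u.
  apply: smooth_at_mulmx; first exact: smooth_at_cst.
  exact/smooth_at_trmx/smooth_at_jacobian.
have SE i j : S i j = 'D_(delta_mx 0 i) (fun v => jacobian h v j 0) u.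
  apply: (eq_trans (jacobian_coord i j (smooth_at_differentiable Ss))).
  by apply: near_eq_derive; apply: filterS hE => v ->; rewrite mxE.
apply/matrixP => i j; rewrite mxE; apply: (eq_trans (SE j i)).
apply: (eq_trans (derive_jacobianC j i 0 hu)).
by rewrite SE.
Qed.

Lemma closed_at_add n (eta theta : 'rV[R]_n -> 'M[R]_n) x :
  smooth_at eta x -> smooth_at theta x ->
  closed_at eta x -> closed_at theta x ->
  closed_at (fun y => eta y + theta y) x.
Proof.
move=> /smooth_at_mx es /smooth_at_mx ts ec tc i j k.
have D l u v : 'D_(delta_mx 0 l) (fun y => (eta y + theta y) u v) x =
    'D_(delta_mx 0 l) (fun y => eta y u v) x
    + 'D_(delta_mx 0 l) (fun y => theta y u v) x.
  rewrite (_ : (fun y => _) = (fun y => eta y u v) + (fun y => theta y u v)).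
    by apply: deriveD; apply: smooth_at_derivable.
  by apply/funext => y; rewrite mxE.
rewrite !D -[RHS](addr0 0) -[X in _ = X + _](ec i j k).
by rewrite -[X in _ = _ + X](tc i j k); ring.
Qed.

Lemma closed_at_cst n (A : 'M[R]_n) x : closed_at (fun=> A) x.
Proof. by move=> i j k; rewrite !derive_cst !addr0. Qed.

(* The canonical form of the cotangent bundle is the pullback of the constant
   form [0, -1; 1, 0] under (z, eta) |-> (psi z, eta). *)
Lemma closed_at_canonical n k (Om : 'rV[R]_n -> 'M[R]_n)
    (psi : 'rV[R]_n -> 'rV[R]_k) z eta :
  smooth_at Om z -> smooth_at psi z -> (Om z)^T = - Om z -> closed_at Om z ->
  closed_at (fun y : 'rV[R]_(n + k) =>
    block_mx (Om (lsubmx y)) (- jacobian psi (lsubmx y))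
             (jacobian psi (lsubmx y))^T 0) (row_mx z eta).
Proof.
move=> Os ps Oalt Oc.
have ls := @smooth_at_lsubmx R 1 n k (row_mx z eta).
have lz : lsubmx (row_mx z eta) = z by rewrite row_mxKl.
have Os' : smooth_at Om (lsubmx (row_mx z eta)) by rewrite lz.
pose J0 : 'M[R]_(k + k) := block_mx 0 (- 1%:M) 1%:M 0.
(* The factor [1%:M] gives [F] the shape that [jacobian_affine] expects. *)
pose F (y : 'rV[R]_(n + k)) := row_mx (psi (lsubmx y)) (rsubmx y *m 1%:M).
have Fs y : smooth_at psi (lsubmx y) -> smooth_at F y.
  move=> psy; rewrite -[y]hsubmxK.
  exact: (smooth_at_affine (g := fun=> 1%:M) _ psy (smooth_at_cst _ _)).
have FE y : smooth_at psi (lsubmx y) ->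
    jacobian F y = block_mx (jacobian psi (lsubmx y)) 0 0 1%:M.
  move=> psy; rewrite -{1}[y]hsubmxK.
  have cs := smooth_at_cst (1%:M : 'M[R]_k) (lsubmx y).
  apply: (eq_trans (jacobian_affine _ psy cs)).
  by rewrite jacobian_cst.
(* The block matrix is the sum of two pullbacks of closed forms: [th1] of [Om] along the projection,
   [th2] of the constant form [J0] along [F]. *)
pose th1 (y : 'rV[R]_(n + k)) :=
  jacobian lsubmx y *m Om (lsubmx y) *m (jacobian lsubmx y)^T.
pose th2 (y : 'rV[R]_(n + k)) := jacobian F y *m J0 *m (jacobian F y)^T.
have ps' : \forall y \near row_mx z eta, smooth_at psi (lsubmx y).
  have N : \forall y \near lsubmx (row_mx z eta), smooth_at psi y.
    by rewrite lz; exact: near_smooth_at ps.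
  exact: (smooth_at_continuous ls N).
have Fz : smooth_at F (row_mx z eta) by apply: Fs; rewrite lz.
have c1 : closed_at th1 (row_mx z eta).
  by apply: (closed_at_pullback (eta := Om) ls); rewrite ?lz.
have c2 : closed_at th2 (row_mx z eta).
  apply: (closed_at_pullback (eta := fun=> J0) Fz).
  - exact: smooth_at_cst.
  - rewrite tr_block_mx opp_block_mx !trmx0 !oppr0 linearN /= !trmx1.
    by rewrite opprK.
  - exact: closed_at_cst.
have s1 : smooth_at th1 (row_mx z eta).
  apply: smooth_at_mulmx; last exact/smooth_at_trmx/smooth_at_jacobian.
  apply: smooth_at_mulmx; first exact: smooth_at_jacobian.
  exact: (smooth_at_comp ls Os').
have s2 : smooth_at th2 (row_mx z eta).
  apply: smooth_at_mulmx; last exact/smooth_at_trmx/smooth_at_jacobian.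
  by apply: smooth_at_mulmx; [exact: smooth_at_jacobian|exact: smooth_at_cst].
apply: near_eq_closed_at (closed_at_add s1 s2 c1 c2).
apply: filterS ps' => y psy; rewrite /th1 /th2 FE// jacobian_lsubmx.
rewrite tr_col_mx trmx1 trmx0 mul_col_mx mul1mx mul0mx mul_col_row.
rewrite mulmx1 mulmx0 mul0mx mul0mx.
rewrite tr_block_mx trmx1 !trmx0 !mulmx_block.
rewrite !(mulmx0, mul0mx, mulmx1, mul1mx, addr0, add0r, mulmxN).
by rewrite add_block_mx !(addr0, add0r).
Qed.

End calculus.

(** * Nondegeneracy and change of coordinates of the block matrix *)

Section linear_algebra.
Variable F : fieldType.

(* The rows of dsubmx A span the kernel of lsubmx G, on which Om is
   nondegenerate. *)
Lemma block_canonical_unitmx n k l (Om : 'M[F]_n) (om : 'M[F]_l)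
    (A : 'M[F]_(k + l, n)) (G : 'M[F]_(n, k + l)) :
  A *m G = 1%:M -> G *m A = 1%:M -> om \in unitmx ->
  om = dsubmx A *m Om *m (dsubmx A)^T ->
  block_mx Om (- lsubmx G) (lsubmx G)^T 0 \in unitmx.
Proof.
move=> AG GA omU omE; rewrite -row_free_unit -kermx_eq0.
apply/rowV0P => v /sub_kermxP.
have AP : A *m lsubmx G = col_mx 1%:M 0.
  have := AG; rewrite -{1}[G]hsubmxK mul_mx_row => /(congr1 lsubmx).
  by rewrite row_mxKl scalar_mx_block block_mxEh row_mxKl.
have NP : dsubmx A *m lsubmx G = 0.
  by have := AP; rewrite -{1}[A]vsubmxK mul_col_mx => /eq_col_mx[].
have UP : usubmx A *m lsubmx G = 1%:M.
  by have := AP; rewrite -{1}[A]vsubmxK mul_col_mx => /eq_col_mx[].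
rewrite -[v]hsubmxK; move: (lsubmx v) (rsubmx v) => u w.
rewrite mul_row_block mulmx0 addr0 mulmxN -row_mx0 => /eq_row_mx[e1 e2].
have uP : u *m lsubmx G = 0 by rewrite -[LHS]opprK e2 oppr0.
have uE : u = u *m rsubmx G *m dsubmx A.
  rewrite -{1}[u]mulmx1 -GA -{1}[G]hsubmxK -{1}[A]vsubmxK mul_row_col.
  by rewrite mulmxDr mulmxA uP mul0mx add0r mulmxA.
(* Pairing [e1] with the vertical rows [dsubmx A] removes the term in [w], since [lsubmx G] kills
   them. What remains is [u *m rsubmx G] times the invertible matrix [om]. *)
have r0 : u *m rsubmx G = 0.
  have := congr1 (mulmx^~ (dsubmx A)^T) e1.
  rewrite mul0mx mulmxDl -[_ *m (lsubmx G)^T *m _]mulmxA -trmx_mul NP trmx0.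
  rewrite mulmx0 addr0 {1}uE -!mulmxA [X in _ *m (_ *m X) = _ -> _]mulmxA -omE.
  by rewrite mulmxA => /(congr1 (mulmx^~ (invmx om))); rewrite mul0mx mulmxK.
have u0 : u = 0 by rewrite uE r0 mul0mx.
(* [usubmx A] is a left inverse of [lsubmx G], so pairing with its rows isolates [w]. *)
have w0 : w = 0.
  have := congr1 (mulmx^~ (usubmx A)^T) e1.
  by rewrite u0 !mul0mx add0r -mulmxA -trmx_mul UP trmx1 mulmx1.
by rewrite u0 w0 row_mx0.
Qed.

(* The quadratic terms of the product cancel because S, a Hessian, is
   symmetric. *)
Lemma mulmx_block_canonical n n' k k' (Om : 'M[F]_n) (Om' : 'M[F]_n')
    (J : 'M[F]_(n, n')) (P : 'M[F]_(n, k)) (P' : 'M[F]_(n', k'))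
    (K : 'M[F]_(k', k)) (S : 'M[F]_k') :
  Om = J *m Om' *m J^T -> P = J *m P' *m K -> S^T = S ->
  let T := block_mx J (J *m P' *m S) 0 K^T in
  block_mx Om (- P) P^T 0 = T *m block_mx Om' (- P') P'^T 0 *m T^T.
Proof.
move=> -> -> Ssym T; rewrite tr_block_mx trmx0 !mulmx_block.
rewrite !(mulmx0, mul0mx, addr0, add0r, trmxK, mulmxN, mulNmx).
rewrite !(trmx_mul, mulmxDl, Ssym, mulmxA, mulNmx).
by congr block_mx; rewrite addrK.
Qed.

(** The rank of a product is at most that of its left factor. Hence a map that pulls some form back
    to a nondegenerate one is an immersion. *)
Lemma row_free_congruence k n (A : 'M[F]_(k, n)) (om : 'M[F]_k) (Om : 'M[F]_n) :
  om \in unitmx -> om = A *m Om *m A^T -> row_free A.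
Proof.
rewrite -row_free_unit /row_free => /eqP omk omE.
rewrite eqn_leq rank_leq_row -{1}omk omE -mulmxA; exact: mxrankM_maxl.
Qed.

End linear_algebra.

(** * The form on the bundle of covectors and its restriction to the zero section *)

Section covector_form.
Variables (R : realType) (b e : nat) (B : charted R b) (E : charted R e).
Variables (p : E -> B) (s : B -> chart R b B).
Hypotheses (Bm : is_manifold B) (Em : is_manifold E).
Hypotheses (psm : forall x, smooth_pt p x).
Hypotheses (sP : forall y, atlas B (s y) /\ chart_dom (s y) y).
Local Notation W := (cov_charted p s).
Local Notation cov := (cov_chart p s).
Let Bc := manifold_chart_space Bm.
Let Ec := manifold_chart_space Em.
Let Wc : chart_space W := chart_space_covector Bm Em psm sP.

(** The factor by which fiber coordinates change, expressed in coordinates of [E]. It depends on the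
    point only through its image in [B]. *)
Definition change_rep (c : chart R e E) (d d' : chart R b B) (z : 'rV[R]_e) :
    'M[R]_b :=
  (jacobian (local_rep d' d id) (local_rep c d' p z))^T.

Section transition.
Variables (c c' : chart R e E) (d d' : chart R b B) (w : W).
Hypotheses (cE : atlas E c) (c'E : atlas E c').
Hypotheses (dB : atlas B d) (d'B : atlas B d').
Hypotheses (cw : chart_dom c (cv_base w)) (c'w : chart_dom c' (cv_base w)).
Hypotheses (dw : chart_dom d (p (cv_base w))).
Hypotheses (d'w : chart_dom d' (p (cv_base w))).
Let tau := local_rep c c' id.
Let psi := local_rep c d' p.
Let chi := local_rep d' d id.
Let z := c (cv_base w).

Lemma near_cov_transition :
  {near cov c d w, (fun y : 'rV[R]_(e + b) =>
     row_mx (tau (lsubmx y)) (rsubmx y *m change_rep c d d' (lsubmx y)))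
   =1 @local_rep _ _ _ W W (cov c d) (cov c' d') id}.
Proof.
have ch : is_chart (cov c d : chart R (e + b) W) by exact: is_chart_cov.
have ch' : is_chart (cov c' d' : chart R (e + b) W) by exact: is_chart_cov.
have N := nbhs_chart_dom ch' (conj c'w d'w : chart_dom (cov c' d') w).
have := near_chart ch (conj cw dw : chart_dom (cov c d) w) N.
apply: filterS => y [[/= c'y d'y] [/= cy dy] _].
by rewrite /local_rep /= to_of_coord.
Qed.

Let tau_smooth : smooth_at tau z.
Proof. exact: (smooth_pt_id _ Em).2. Qed.

Let psi_smooth : smooth_at psi z.
Proof. exact: (psm _).2. Qed.

Let psiE : psi z = d' (p (cv_base w)).
Proof. exact: local_rep_at. Qed.

Let chi_smooth : smooth_at chi (psi z).
Proof. by rewrite psiE; exact: (smooth_pt_id _ Bm).2. Qed.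

Let change_smooth : smooth_at (change_rep c d d') z.
Proof.
apply: smooth_at_trmx; apply: (smooth_at_comp psi_smooth).
exact: smooth_at_jacobian.
Qed.

Lemma smooth_at_cov_transition :
  smooth_at (@local_rep _ _ _ W W (cov c d) (cov c' d') id) (cov c d w).
Proof.
apply: near_eq_smooth_at near_cov_transition _.
exact: (smooth_at_affine _ tau_smooth change_smooth).
Qed.

(** The change of fiber coordinates factors through the projection, so by the chain rule its
    derivative is the Jacobian of [p] times a Hessian [S] on [B]. This factorization is what
    [mulmx_block_canonical] needs. *)
Lemma jac_cov_transition : exists S : 'M[R]_b, S^T = S /\
  @jac _ _ _ W W id (cov c d) (cov c' d') w =
  block_mx (jac id c c' (cv_base w))
    (jac id c c' (cv_base w) *m jac p c' d' (cv_base w) *m S)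
    0 (jac id d' d (p (cv_base w)))^T.
Proof.
exists (jacobian (fun u => to_coord d w *m (jacobian chi u)^T) (psi z)).
split; first exact: jacobian_row_jacobian_sym.
have T0 := smooth_at_affine (to_coord d w) tau_smooth change_smooth.
have := near_eq_jacobian near_cov_transition (smooth_at_differentiable T0).
rewrite /jac => <-.
apply: (eq_trans (jacobian_affine (to_coord d w) tau_smooth change_smooth)).
have Ks : smooth_at (fun u => to_coord d w *m (jacobian chi u)^T) (psi z).
  apply: smooth_at_mulmx; first exact: smooth_at_cst.
  exact/smooth_at_trmx/smooth_at_jacobian.
have EH := jacobian_comp (smooth_at_differentiable psi_smooth)
  (smooth_at_differentiable Ks).
have EJ := jac_changel Em (psm (cv_base w)) cE c'E d'B cw c'w d'w.
have EG := congr1 (fun u => (jacobian chi u)^T) psiE.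
have EH' := eq_trans EH (congr1 (mulmx^~ _) EJ).
exact: (f_equal2 (fun X Y => block_mx (jac id c c' (cv_base w)) X 0 Y) EH' EG).
Qed.

End transition.

Lemma is_manifold_covector : is_manifold W.
Proof.
split.
- exact: hausdorff_covector.
- exact: second_countable_covector.
- exact: Wc.1.
- exact: Wc.2.
move=> _ _ [c [d [cE dB ->]]] [c' [d' [c'E d'B ->]]].
have ch : is_chart (cov c d : chart R (e + b) W) by exact: is_chart_cov.
have ch' : is_chart (cov c' d' : chart R (e + b) W) by exact: is_chart_cov.
apply/Cinfty_onP.
  apply: (open_chart_image ch); last by move=> w [].
  by apply: openI; [have [] := ch|have [] := ch'].
by move=> _ [w [[cw dw] [c'w d'w]] <-]; exact: smooth_at_cov_transition.
Qed.

Variables (Omega : form_data E).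
Hypothesis OmegaF : closed_two_form Omega.

(** The argument is a point of [E]: the canonical form has coefficients independent of the
    covector. *)
Definition cov_block (c : chart R e E) (d : chart R b B) (x : E) :
    'M[R]_(e + b) :=
  block_mx (Omega c x) (- jac p c d x) (jac p c d x)^T 0.

Lemma cov_block_transition c c' d d' (w : W) :
  atlas E c -> atlas E c' -> atlas B d -> atlas B d' ->
  chart_dom c (cv_base w) -> chart_dom c' (cv_base w) ->
  chart_dom d (p (cv_base w)) -> chart_dom d' (p (cv_base w)) ->
  let J := @jac _ _ _ W W id (cov c d) (cov c' d') w in
  cov_block c d (cv_base w) = J *m cov_block c' d' (cv_base w) *m J^T.
Proof.
move=> cE c'E dB d'B cw c'w dw d'w J.
have [S [Ssym JE]] := jac_cov_transition cE c'E dB d'B cw c'w dw d'w.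
rewrite /J JE; apply: (mulmx_block_canonical (J := jac id c c' (cv_base w))
  (K := jac id d' d (p (cv_base w)))) => //.
  exact: (two_form_transition OmegaF.1 cE c'E cw c'w).
rewrite (jac_changel Em (psm (cv_base w)) cE c'E dB cw c'w dw) -mulmxA.
by rewrite (jac_changer Ec Bm (psm (cv_base w)) c'E d'B dB c'w d'w dw).
Qed.

Lemma near_cov_block c d w : atlas E c -> atlas B d ->
  chart_dom c (cv_base w) -> chart_dom d (p (cv_base w)) ->
  {near cov c d w, (fun y : 'rV[R]_(e + b) =>
    block_mx (Omega c (chart_inv c (lsubmx y)))
       (- jacobian (local_rep c d p) (lsubmx y))
       (jacobian (local_rep c d p) (lsubmx y))^T 0)
   =1 (fun y => cov_block c d (cv_base (chart_inv (cov c d) y : W)))}.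
Proof.
move=> cE dB cw dw.
have ch : is_chart (cov c d : chart R (e + b) W) by exact: is_chart_cov.
have cdw : chart_dom (cov c d) w by [].
have := near_chart ch cdw (@filterT _ _ (nbhs_filter w)).
apply: filterS => y [_ [/= cy dy] yE].
have lE : c (chart_inv c (lsubmx y)) = lsubmx y by rewrite -{2}yE row_mxKl.
by rewrite /cov_block /jac lE.
Qed.

Lemma smooth_at_form c x : atlas E c -> chart_dom c x ->
  smooth_at (fun y => Omega c (chart_inv c y)) (c x).
Proof.
move=> cE cx; have [_ oc _ _ _] := Ec.1 _ cE.
by have /Cinfty_onP := two_form_smooth OmegaF.1 cE; apply => //; exists x.
Qed.

Lemma smooth_at_cov_block c d w : atlas E c -> atlas B d ->
  chart_dom c (cv_base w) -> chart_dom d (p (cv_base w)) ->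
  smooth_at (fun y => cov_block c d (cv_base (chart_inv (cov c d) y : W)))
            (cov c d w).
Proof.
move=> cE dB cw dw; apply: near_eq_smooth_at (near_cov_block cE dB cw dw) _.
have ls := @smooth_at_lsubmx R 1 e b (cov c d w).
have lE : lsubmx (cov c d w) = c (cv_base w) by rewrite row_mxKl.
have Js : smooth_at (jacobian (local_rep c d p)) (c (cv_base w)).
  by apply: smooth_at_jacobian; exact: (psm _).2.
have Js' : smooth_at (fun y : 'rV[R]_(e + b) =>
    jacobian (local_rep c d p) (lsubmx y)) (cov c d w).
  by apply: (smooth_at_comp (g := jacobian _) ls); rewrite lE.
apply: smooth_at_block_mx.
- apply: (smooth_at_comp (g := fun y => Omega c (chart_inv c y)) ls).
  by rewrite lE; exact: smooth_at_form.
- exact: smooth_at_opp.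
- exact: smooth_at_trmx.
- exact: smooth_at_cst.
Qed.

Lemma closed_at_cov_block c d w : atlas E c -> atlas B d ->
  chart_dom c (cv_base w) -> chart_dom d (p (cv_base w)) ->
  closed_at (fun y => cov_block c d (cv_base (chart_inv (cov c d) y : W)))
            (cov c d w).
Proof.
move=> cE dB cw dw; apply: near_eq_closed_at (near_cov_block cE dB cw dw) _.
have [_ _ cK _ _] := Ec.1 _ cE.
apply: (closed_at_canonical (Om := fun y => Omega c (chart_inv c y))).
- exact: smooth_at_form.
- exact: (psm _).2.
- by rewrite cK//; exact: (two_form_alternating OmegaF.1 cE cw).
- by move/closed_formP: OmegaF.2; apply => //; exists (cv_base w).
Qed.

Lemma covector_form_exists : exists Lambda : form_data W,
  closed_two_form Lambda /\
  forall k, atlas W k -> exists c d, [/\ atlas E c, atlas B d, k = cov c d &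
    forall w, Lambda k w = cov_block c d (cv_base w)].
Proof.
(* A form must be a function of the chart, but a chart of [W] does not record the pair it comes
   from, so a pair is chosen for each; charts outside the atlas receive the value 0. *)
have /choice[Lambda LP] : forall k : chart R (e + b) W,
    exists L : W -> 'M[R]_(e + b), atlas W k ->
    exists c d, [/\ atlas E c, atlas B d, k = cov c d &
      forall w, L w = cov_block c d (cv_base w)].
  move=> k; have [[c [d [cE dB kE]]]|nk] := pselect (atlas W k).
    by exists (fun w => cov_block c d (cv_base w)) => _; exists c, d.
  by exists (fun=> 0) => /nk.
exists Lambda; split=> //; split; first split.
- move=> k w /LP[c [d [cE dB -> ->]]] [/= cw dw].
  rewrite tr_block_mx opp_block_mx trmxK trmx0 oppr0 linearN /= opprK.
  by rewrite (two_form_alternating OmegaF.1 cE cw).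
- move=> k kW; have [c [d [cE dB kE LE]]] := LP k kW.
  have [_ ok _ _ _] := Wc.1 _ kW.
  apply/Cinfty_onP => // _ [w + <-]; rewrite {1}kE => -[/= cw dw].
  have -> : (fun y => Lambda k (chart_inv k y)) =
      (fun y => cov_block c d (cv_base (chart_inv (cov c d) y : W))).
    by apply/funext => y; rewrite LE kE.
  by rewrite kE; exact: smooth_at_cov_block.
- move=> k k' w /LP[c [d [cE dB -> LE]]] /LP[c' [d' [c'E d'B -> LE']]].
  move=> [cw dw] [c'w d'w] J; apply: (eq_trans (LE w)).
  apply: (eq_trans (cov_block_transition cE c'E dB d'B cw c'w dw d'w)).
  exact: (congr1 (fun X => J *m X *m J^T) (esym (LE' w))).
apply/closed_formP => k _ kW [w + <-]; have [c [d [cE dB kE LE]]] := LP k kW.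
rewrite {1}kE => -[/= cw dw].
have -> : (fun y => Lambda k (chart_inv k y)) =
    (fun y => cov_block c d (cv_base (chart_inv (cov c d) y : W))).
  by apply/funext => y; rewrite LE kE.
by rewrite kE; exact: closed_at_cov_block.
Qed.

Definition zero_section (x : E) : W := Covector p s x 0.

Lemma smooth_pt_zero_section x : smooth_pt zero_section x.
Proof.
split.
  have [d dB dx] := Bc.2 (p x).
  (* Zero coordinates are zero in every chart, so the factor coming from [s] disappears and the
     equality holds even off the domain of [d]. *)
  have -> : zero_section = of_coord p s d \o (fun x => (x, 0)).
    by apply/funext => x'; rewrite /of_coord /= mul0mx.
  have ic : {for x, continuous (fun x : E => x)} by exact: cvg_id.
  have zc : {for x, continuous (fun _ : E => 0 : 'rV[R]_b)} by exact: cvg_cst.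
  have pc : {for x, continuous (fun x : E => (x, 0 : 'rV[R]_b))}.
    exact: cvg_pair ic zc.
  have oc := @continuous_of_coord _ _ _ B E p s d (x, 0) dB dx.
  exact: (continuous_comp pc oc).
move=> c _ cE [c' [d [c'E dB ->]]] cx [/= c'x dx].
have -> : @local_rep _ _ _ E W c (cov c' d) zero_section =
    (fun z => row_mx (local_rep c c' id z) 0).
  by apply/funext => z; rewrite /local_rep /= /to_coord /= mul0mx.
apply: smooth_at_row_mx; last exact: smooth_at_cst.
exact: (smooth_pt_id _ Em).2.
Qed.

(** The zero section has Jacobian [J, 0], which selects the upper left block; this leaves [Omega]
    with its own change of charts. *)
Lemma is_pullback_zero_section (Lambda : form_data W) :
  (forall k, atlas W k -> exists c d, [/\ atlas E c, atlas B d, k = cov c d &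
    forall w, Lambda k w = cov_block c d (cv_base w)]) ->
  is_pullback zero_section Lambda Omega.
Proof.
move=> LP c k x cE kW cx kx /=; have [c' [d [c'E dB kE ->]]] := LP k kW.
rewrite {}kE in kx *; have [/= c'x dx] := kx.
have -> : jacobian (@local_rep _ _ _ E W c (cov c' d) zero_section) (c x) =
    row_mx (jac id c c' x) 0.
  have -> : @local_rep _ _ _ E W c (cov c' d) zero_section =
      (fun z => row_mx (local_rep c c' id z) 0).
    by apply/funext => z; rewrite /local_rep /= /to_coord /= mul0mx.
  rewrite jacobian_row_mx; last exact: smooth_at_cst.
    by rewrite jacobian_cst.
  exact: (smooth_pt_id _ Em).2.
rewrite /cov_block /= mul_row_block tr_row_mx mul_row_col.
rewrite trmx0 !(mul0mx, mulmx0, addr0).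
exact: (two_form_transition OmegaF.1 cE c'E cx c'x).
Qed.

End covector_form.

(** * Configurations and closed connection forms *)

Section main_lemmas.
Variables (R : realType) (m b e : nat).
Variables (M : charted R m) (B : charted R b) (E : charted R e).
Variables (omega : form_data M) (p : E -> B) (T : set (triv M B E)).
Hypotheses (Mm : is_manifold M) (omegaS : symplectic_form omega).
Hypothesis (bundleE : symplectic_bundle omega p T).
Let Mc := manifold_chart_space Mm.
Let Bm := bundle_base bundleE.
Let Bc := manifold_chart_space Bm.
Let Em := bundle_total bundleE.
Let Ec := manifold_chart_space Em.
Let psm := smooth_pt_proj bundleE.

Lemma configuration_connection : symplectic_configuration omega T ->
  exists Omega : form_data E, closed_connection_form omega T Omega.
Proof.
move=> [w [W [omegaW [f [[Wm [omegaWc _]] fsm fT]]]]].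
have Wc := manifold_chart_space Wm.
have fs : forall x, smooth_pt f x by apply/smooth_mapP.
have [Om OE] := pullback_exists Ec Wm fs omegaWc.1.
exists Om; split; first exact: closed_two_form_pullback Em Wc fs OE omegaWc.
move=> t y Tt ty; have [_ ftE] := fT t y Tt ty.
apply: (is_pullback_comp_left Mc Ec Wc _ fs ftE OE) => x.
exact: (smooth_pt_fiber_param Mm bundleE Tt x ty).
Qed.

Variables (Omega : form_data E).
Hypothesis (OmegaC : closed_connection_form omega T Omega).

(** [vertical_splitting] identifies the off-diagonal block with a block of an invertible Jacobian,
    and the fiber condition on [Omega] gives its nondegeneracy on the complementary rows. *)
Lemma cov_block_unitmx x c d : atlas E c -> atlas B d ->
  chart_dom c x -> chart_dom d (p x) -> cov_block p Omega c d x \in unitmx.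
Proof.
move=> cE dB cx dx.
have [t [y [a [z [F [G]]]]]] := vertical_splitting Mm bundleE cE dB cx dx.
move=> [[Tt ty] [aM az] zx [FG GF] [pG NF]].
have cz : chart_dom c (fiber_param t y z) by rewrite zx.
have omE := OmegaC.2 t y Tt ty a c z aM cE az cz.
rewrite /= zx -/(jac _ _ _ _) NF in omE.
rewrite /cov_block pG.
exact: block_canonical_unitmx FG GF (omegaS.2 _ _ aM az) omE.
Qed.

(** Composing [r] with the trivialization recovers the point of [M] continuously from its image,
    which gives injectivity and the induced topology. Nondegeneracy of [omega] gives the immersion
    property. *)
Lemma fiber_embedding w (W : charted R w) (g : E -> W) (r : W -> E)
    (Lambda : form_data W) t y :
  T t -> triv_dom t y -> chart_space W -> continuous r -> cancel g r ->
  (forall x, smooth_pt g x) -> is_pullback g Lambda Omega ->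
  symplectic_embedding omega Lambda (g \o fiber_param t y).
Proof.
move=> Tt ty Wc rc gK gs gE.
have fs x : smooth_pt (fiber_param t y) x.
  exact: (smooth_pt_fiber_param Mm bundleE Tt x ty).
have gfs x : smooth_pt (g \o fiber_param t y) x.
  by apply: smooth_pt_comp.
have gfE : is_pullback (g \o fiber_param t y) Lambda omega.
  exact: is_pullback_comp Mc Ec fs gs (OmegaC.2 t y Tt ty) gE.
have fK x : triv_fun t (fiber_param t y x) = (y, x).
  exact: (triv_invK bundleE Tt (z := (y, x))).
have fp x : p (fiber_param t y x) = y.
  exact: (proj_triv_inv bundleE Tt (z := (y, x))).
split=> //; split.
- exact/smooth_mapP.
- move=> c k x cM kW cx kx; apply: row_free_congruence (omegaS.2 _ _ cM cx) _.
  exact: gfE.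
- move=> x x' /= /(congr1 r); rewrite !gK => /(congr1 (triv_fun t)).
  by rewrite !fK => -[].
move=> U oU.
exists (r @^-1` [set x | triv_dom t (p x) /\ U (triv_fun t x).2]).
  apply: open_comp => [? _|]; first exact: rc.
  rewrite openE => x [tx Ux].
  have oT := open_proj_preimage bundleE (open_triv_dom bundleE Tt).
  have N1 := open_nbhs_nbhs (conj oT tx).
  have tc := (smooth_pt_triv_fun Mm bundleE Tt tx).1.
  have N2 : nbhs x (fun x => U (triv_fun t x).2).
    have sc : {for x, continuous (snd \o triv_fun t)}.
      by apply: (continuous_comp tc); exact: cvg_snd.
    exact: (sc _ (open_nbhs_nbhs (conj oU Ux))).
  exact: filterI N1 N2.
apply/seteqP; split=> [x Ux|x] /=; rewrite gK fK fp //.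
by case.
Qed.

Lemma connection_configuration : symplectic_configuration omega T.
Proof.
have /choice[s sP] : forall y : B, exists d, atlas B d /\ chart_dom d y.
  by move=> y; have [d dB dy] := Bc.2 y; exists d.
have Wm := is_manifold_covector Bm Em psm sP.
have Wc := manifold_chart_space Wm.
have [Lambda [Lc LP]] := covector_form_exists Bm Em psm sP OmegaC.1.
have zs := smooth_pt_zero_section p s Bm Em.
exists (e + b)%N, (cov_charted p s), Lambda, (@zero_section _ _ _ B E p s).
split.
- split=> //; split=> // k w kW; have [c [d [cE dB kE ->]]] := LP k kW.
  by rewrite kE => -[/= cw dw]; exact: cov_block_unitmx.
- exact/smooth_mapP.
have PZ := is_pullback_zero_section Em OmegaC.1 LP.
have rc : continuous (@cv_base _ _ _ B E p s : cov_charted p s -> E).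
  exact: continuous_cv_base.
have zK : cancel (@zero_section _ _ _ B E p s) (@cv_base _ _ _ B E p s) by [].
by move=> t y Tt ty; exact: (fiber_embedding Tt ty Wc rc zK zs PZ).
Qed.

End main_lemmas.

Theorem lemma2p5 (R : realType) (m b e : nat)
    (M : charted R m) (B : charted R b) (E : charted R e)
    (omega : form_data M) (p : E -> B) (T : set (triv M B E))
    (hM : closed_manifold M) (homega : symplectic_form omega)
    (hE : symplectic_bundle omega p T) :
  symplectic_configuration omega T <->
  exists Omega : form_data E, closed_connection_form omega T Omega.
Proof.
split; first exact: configuration_connection hM.1 hE.
by move=> [Om]; exact: connection_configuration hM.1 homega hE Om.
Qed.
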